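(* Let $G=\langle a,b\rangle\le \mathrm{Aut}(T)$ be the group generated by the recursively defined automorphisms $a=(1,b)$, $b=(1,a)\varepsilon$ of the rooted binary tree $T$. Let $(Z_n)_{n\ge 0}$ be a symmetric random walk on $G$ with step distribution supported on $\{a,a^{-1},b,b^{-1}\}$. Then $$\lim_{n\to\infty} \frac{|Z_n|}{n}=0\quad\text{with probability }1.$$
   Context: $T$ is the rooted binary tree with vertex set $V$ consisting of all finite binary sequences and edge set $\{(v,vi): v\in V,\ i\in\{0,1\}\}$. Automorphisms act on the right, written $g: v\mapsto v^g$, so $v^{gh}=(v^g)^h$. For $g,h\in\mathrm{Aut}(T)$, $(g,h)$ denotes the automorphism sending $0v\mapsto 0v^g$ and $1v\mapsto 1v^h$. The automorphism $\varepsilon$ sends $iv$ to $((i+1)\bmod 2)v$ for $i\in\{0,1\}$. The elements $a,b$ are the unique automorphisms satisfying $a=(1,b)$ and $b=(1,a)\varepsilon$. $|g|$ denotes the word length of $g\in G$ with respect to the generating set $\{a^{\pm1},b^{\pm1}\}$. The random walk is $Z_0=1$, $Z_n=s_1s_2\cdots s_n$ with $s_i$ i.i.d.; the step distribution gives equal positive weight to $a$ and $a^{-1}$ and equal positive weight to $b$ and $b^{-1}$ (i.e. weights proportional to $(1,1,r,r)$ on $(a,a^{-1},b,b^{-1})$ for some $r>0$). *)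

(* Defs.v *)
From HB Require Import structures.
From mathcomp Require Import all_boot all_order all_algebra finmap.
From mathcomp Require Import all_classical all_reals all_analysis.
Import Order.TTheory GRing.Theory Num.Theory.
Import numFieldNormedType.Exports.

Set Implicit Arguments.
Unset Strict Implicit.
Unset Printing Implicit Defensive.

Local Open Scope classical_set_scope.
Local Open Scope group_scope.

(* [false] and [true] stand for the letters 0 and 1. *)
Definition vertex : Type := seq bool.

Definition tree_edge (u v : vertex) : bool := [exists i : bool, v == rcons u i].

Definition tree_adj (u v : vertex) : bool := tree_edge u v || tree_edge v u.

Definition is_tree_aut (f : vertex -> vertex) : Prop :=
  [/\ bijective f, f [::] = [::] & forall u v, tree_adj (f u) (f v) = tree_adj u v].

Record tree_aut := TreeAut
  { tree_act :> vertex -> vertex ; _ : `[< is_tree_aut tree_act >] }.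

HB.instance Definition _ := [isSub for tree_act].
HB.instance Definition _ := [Choice of tree_aut by <:].

Lemma tree_autP (g : tree_aut) : is_tree_aut g.
Proof. by case: g => f /= /asboolP. Qed.

Lemma tree_autE (g h : tree_aut) : g =1 h -> g = h.
Proof. by move=> gh; apply/val_inj/funext. Qed.

Definition mk_tree_aut f (hf : is_tree_aut f) : tree_aut :=
  TreeAut (asboolT hf).

Lemma is_tree_aut_id : is_tree_aut id.
Proof. by split => //; exists id. Qed.

(* Automorphisms act on the right: [g * h] is [g] followed by [h]. *)
Lemma is_tree_aut_comp (g h : tree_aut) : is_tree_aut (fun v => h (g v)).
Proof.
have [gb g0 gE] := tree_autP g; have [hb h0 hE] := tree_autP h.
split; first exact: (bij_comp hb gb).
- by rewrite g0.
- by move=> u v; rewrite hE gE.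
Qed.

Lemma tree_aut_bij (g : tree_aut) :
  exists f, [/\ is_tree_aut f, cancel g f & cancel f g].
Proof.
have [[f gK fK] g0 gE] := tree_autP g; exists f; split=> //; split.
- by exists g.
- by rewrite -g0 gK.
- by move=> u v; rewrite -gE !fK.
Qed.

Definition tree_aut_one : tree_aut := mk_tree_aut is_tree_aut_id.
Definition tree_aut_mul (g h : tree_aut) : tree_aut :=
  mk_tree_aut (is_tree_aut_comp g h).
Definition tree_aut_inv (g : tree_aut) : tree_aut :=
  let: exist _ hf := cid (tree_aut_bij g) in
  let: And3 hf _ _ := hf in mk_tree_aut hf.

Lemma tree_aut_invK (g : tree_aut) :
  cancel g (tree_aut_inv g) /\ cancel (tree_aut_inv g) g.
Proof. by rewrite /tree_aut_inv; case: cid => f [hf]. Qed.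

Lemma tree_aut_mulA : associative tree_aut_mul.
Proof. by move=> g h k; apply: tree_autE. Qed.
Lemma tree_aut_mul1g : left_id tree_aut_one tree_aut_mul.
Proof. by move=> g; apply: tree_autE. Qed.
Lemma tree_aut_mulg1 : right_id tree_aut_one tree_aut_mul.
Proof. by move=> g; apply: tree_autE. Qed.
Lemma tree_aut_mulVg : left_inverse tree_aut_one tree_aut_inv tree_aut_mul.
Proof. by move=> g; apply: tree_autE => v; apply: (tree_aut_invK g).2. Qed.
Lemma tree_aut_mulgV : right_inverse tree_aut_one tree_aut_inv tree_aut_mul.
Proof. by move=> g; apply: tree_autE => v; apply: (tree_aut_invK g).1. Qed.

HB.instance Definition _ := isGroup.Build tree_aut
  tree_aut_mulA tree_aut_mul1g tree_aut_mulg1 tree_aut_mulVg tree_aut_mulgV.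

Lemma tree_act1 v : (1 : tree_aut) v = v. Proof. by []. Qed.

Lemma tree_actM (g h : tree_aut) v : (g * h) v = h (g v). Proof. by []. Qed.

Lemma tree_adj_nil_cons i v : tree_adj [::] (i :: v) = (v == [::]).
Proof.
apply/orP/eqP => [[/existsP[j /eqP[_ //]]|/existsP[j]]|->].
  by rewrite rcons_cons.
by left; apply/existsP; exists i.
Qed.

Lemma tree_adjC u v : tree_adj u v = tree_adj v u.
Proof. exact: orbC. Qed.

Lemma tree_adj_cons i j u v :
  tree_adj (i :: u) (j :: v) = (i == j) && tree_adj u v.
Proof.
have E i' j' (u' v' : vertex) :
    tree_edge (i' :: u') (j' :: v') = (i' == j') && tree_edge u' v'.
  apply/existsP/andP => [[k]|[/eqP-> /existsP[k /eqP->]]].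
    rewrite rcons_cons eqseq_cons => /andP[/eqP -> vk]; split=> //.
    by apply/existsP; exists k.
  by exists k.
by rewrite /tree_adj !E (eq_sym j) -andb_orr.
Qed.

Lemma tree_aut_nil (g : tree_aut) v : (g v == [::]) = (v == [::]).
Proof.
have [gb g0 _] := tree_autP g.
by rewrite -{1}g0 (inj_eq (bij_inj gb)).
Qed.

Definition pair_act (g h : vertex -> vertex) (v : vertex) : vertex :=
  match v with
  | [::] => [::]
  | false :: w => false :: g w
  | true :: w => true :: h w
  end.

Lemma is_tree_aut_pair (g h : tree_aut) : is_tree_aut (pair_act g h).
Proof.
have [_ _ gE] := tree_autP g; have [_ _ hE] := tree_autP h.
split=> //.
- exists (pair_act (tree_aut_inv g) (tree_aut_inv h)) => -[|[] v] //=.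
  + by rewrite (tree_aut_invK h).1.
  + by rewrite (tree_aut_invK g).1.
  + by rewrite (tree_aut_invK h).2.
  + by rewrite (tree_aut_invK g).2.
- move=> [|[] u] [|[] v] //=; rewrite ?tree_adj_cons ?hE ?gE //.
  + by rewrite !tree_adj_nil_cons tree_aut_nil.
  + by rewrite !tree_adj_nil_cons tree_aut_nil.
  + by rewrite !(tree_adjC _ [::]) !tree_adj_nil_cons tree_aut_nil.
  + by rewrite !(tree_adjC _ [::]) !tree_adj_nil_cons tree_aut_nil.
Qed.

Definition pair_aut (g h : tree_aut) : tree_aut :=
  mk_tree_aut (is_tree_aut_pair g h).

Definition swap_act (v : vertex) : vertex :=
  if v is i :: w then ~~ i :: w else [::].

Lemma is_tree_aut_swap : is_tree_aut swap_act.
Proof.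
split=> //; first by exists swap_act => -[|[] v].
move=> [|i u] [|j v] //=.
- by rewrite !tree_adj_nil_cons.
- by rewrite !(tree_adjC _ [::]) !tree_adj_nil_cons.
- by rewrite !tree_adj_cons (inj_eq negb_inj).
Qed.

Definition epsilon : tree_aut := mk_tree_aut is_tree_aut_swap.

Fixpoint a_act (v : vertex) : vertex :=
  match v with
  | [::] => [::]
  | false :: w => false :: w
  | true :: w => true :: b_act w
  end
with b_act (v : vertex) : vertex :=
  match v with
  | [::] => [::]
  | false :: w => true :: w
  | true :: w => false :: a_act w
  end.

Fixpoint a_inv_act (v : vertex) : vertex :=
  match v with
  | [::] => [::]
  | false :: w => false :: w
  | true :: w => true :: b_inv_act w
  end
with b_inv_act (v : vertex) : vertex :=
  match v with
  | [::] => [::]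
  | true :: w => false :: w
  | false :: w => true :: a_inv_act w
  end.

Lemma ab_actK v : (a_inv_act (a_act v) = v /\ b_inv_act (b_act v) = v) /\
                  (a_act (a_inv_act v) = v /\ b_act (b_inv_act v) = v).
Proof. by elim: v => [|[] v [[IH1 IH2] [IH3 IH4]]] /=; rewrite ?IH1 ?IH2 ?IH3 ?IH4. Qed.

Lemma ab_act_nil v :
  (a_act v == [::]) = (v == [::]) /\ (b_act v == [::]) = (v == [::]).
Proof. by case: v => [|[] v]. Qed.

Lemma ab_act_adj u v : tree_adj (a_act u) (a_act v) = tree_adj u v /\
                       tree_adj (b_act u) (b_act v) = tree_adj u v.
Proof.
elim: u v => [|i u IH] [|j v] //.
- by case: j; rewrite /= !tree_adj_nil_cons ?(ab_act_nil v).1 ?(ab_act_nil v).2.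
- by case: i; rewrite /= !(tree_adjC _ [::]) !tree_adj_nil_cons ?(ab_act_nil u).1 ?(ab_act_nil u).2.
- by case: i; case: j; rewrite /= !tree_adj_cons ?(IH v).1 ?(IH v).2.
Qed.

Lemma is_tree_aut_a : is_tree_aut a_act.
Proof.
split=> //; last by move=> u v; case: (ab_act_adj u v).
by exists a_inv_act => v; case: (ab_actK v) => [[? ?] [? ?]].
Qed.

Lemma is_tree_aut_b : is_tree_aut b_act.
Proof.
split=> //; last by move=> u v; case: (ab_act_adj u v).
by exists b_inv_act => v; case: (ab_actK v) => [[? ?] [? ?]].
Qed.

Definition aut_a : tree_aut := mk_tree_aut is_tree_aut_a.
Definition aut_b : tree_aut := mk_tree_aut is_tree_aut_b.

Lemma aut_aE : aut_a = pair_aut 1 aut_b.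
Proof. by apply: tree_autE => -[|[] v]. Qed.

Lemma aut_bE : aut_b = pair_aut 1 aut_a * epsilon.
Proof. by apply: tree_autE => -[|[] v]. Qed.

Lemma aut_ab_unique (x y : tree_aut) :
  x = pair_aut 1 y -> y = pair_aut 1 x * epsilon -> x = aut_a /\ y = aut_b.
Proof.
move=> xE yE; suff H v : x v = aut_a v /\ y v = aut_b v.
  by split; apply: tree_autE => v; have [] := H v.
elim: v => [|i v [IHx IHy]].
  by split; [have [_ -> _] := tree_autP x | have [_ -> _] := tree_autP y].
by split; [rewrite xE aut_aE | rewrite yE aut_bE]; case: i => //=;
  rewrite ?tree_actM /= ?IHx ?IHy.
Qed.

Definition generated (gT : groupType) (X : seq gT) : {pred gT} :=
  fun g => `[< forall H : {pred gT}, group_closed H -> {subset X <= H} -> g \in H >].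

Lemma generatedP (gT : groupType) (X : seq gT) g :
  reflect (forall H : {pred gT}, group_closed H -> {subset X <= H} -> g \in H)
          (g \in generated X).
Proof. exact: asboolP. Qed.

Lemma generated_group_closed (gT : groupType) (X : seq gT) :
  group_closed (generated X).
Proof.
split=> [|x y /generatedP hx /generatedP hy]; apply/generatedP => H hH XH.
  exact: hH.1.
by apply: hH.2; [apply: hx | apply: hy].
Qed.

Lemma mem_generated (gT : groupType) (X : seq gT) : {subset X <= generated X}.
Proof. by move=> x xX; apply/generatedP => H _; apply. Qed.

Record basilica := Basilica
  { basilica_val :> tree_aut ; _ : basilica_val \in generated [:: aut_a; aut_b] }.

HB.instance Definition _ := [isSub for basilica_val].
HB.instance Definition _ := [Choice of basilica by <:].
HB.instance Definition _ := SubChoice_isSubGroup.Build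
  tree_aut (generated [:: aut_a; aut_b]) basilica
  (generated_group_closed [:: aut_a; aut_b]).

Lemma aut_a_in : aut_a \in generated [:: aut_a; aut_b].
Proof. by apply: mem_generated; rewrite inE eqxx. Qed.
Lemma aut_b_in : aut_b \in generated [:: aut_a; aut_b].
Proof. by apply: mem_generated; rewrite !inE eqxx orbT. Qed.

Definition gen_a : basilica := Basilica aut_a_in.
Definition gen_b : basilica := Basilica aut_b_in.

Definition basilica_gens : seq basilica :=
  [:: gen_a; gen_a^-1; gen_b; gen_b^-1].

Definition has_word (g : basilica) (n : nat) : bool :=
  `[< exists w : seq basilica,
      [/\ {subset w <= basilica_gens}, size w = n & \prod_(s <- w) s = g] >].

Lemma basilica_gensV s : s \in basilica_gens -> s^-1 \in basilica_gens.
Proof.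
by rewrite !inE => /or4P[] /eqP ->; rewrite ?invgK eqxx ?orbT.
Qed.

Lemma has_word_ex (g : basilica) : exists n, has_word g n.
Proof.
pose H : {pred tree_aut} := fun x =>
  `[< exists w : seq basilica,
      {subset w <= basilica_gens} /\ val (\prod_(s <- w) s) = x >].
have prodV (w : seq basilica) :
    (\prod_(s <- w) s)^-1 = \prod_(s <- rev [seq s^-1 | s <- w]) s.
  elim: w => [|s w IH]; first by rewrite !big_nil invg1.
  by rewrite big_cons invgM IH /= rev_cons -cats1 big_cat big_seq1.
have HG : group_closed H.
  split=> [|x y /asboolP[u [uS <-]] /asboolP[w [wS <-]]]; apply/asboolP.
    by exists [::]; split=> //; rewrite big_nil.
  exists (u ++ rev [seq s^-1 | s <- w]); split=> [s|].
    rewrite mem_cat mem_rev => /orP[/uS //|/mapP[t /wS tS ->]].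
    exact: basilica_gensV.
  by rewrite big_cat /= -prodV.
case: g => x hx.
have /asboolP[w [wS wE]] : x \in H.
  have /generatedP/(_ H HG) := hx; apply => y; rewrite !inE => /orP[] /eqP ->.
    exists [:: gen_a]; rewrite big_seq1; split=> // s.
    by rewrite mem_seq1 => /eqP ->; rewrite mem_head.
  exists [:: gen_b]; rewrite big_seq1; split=> // s.
  by rewrite mem_seq1 => /eqP ->; rewrite !in_cons eqxx !orbT.
exists (size w); apply/asboolP; exists w; split=> //.
exact: val_inj.
Qed.

Definition word_length (g : basilica) : nat := ex_minn (has_word_ex g).

(* [G] is countable; it carries the discrete sigma-algebra. *)
HB.instance Definition _ := isPointed.Build basilica (1 : basilica).
HB.instance Definition _ := @isMeasurable.Build default_measure_display
  basilica discrete_measurable discrete_measurable0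
  discrete_measurableC discrete_measurableU.

Local Open Scope ereal_scope.

Definition mutually_independent (d d' : measure_display)
    (Omega : measurableType d) (T : measurableType d') (R : realType)
    (P : probability Omega R) (X : nat -> {RV P >-> T}) : Prop :=
  forall (J : {fset nat}) (A : nat -> set T), (forall j, measurable (A j)) ->
    P (\bigcap_(j in [set` J]) (X j @^-1` A j)) =
    \prod_(j <- J) P (X j @^-1` A j).

(* The probability measure on [G] whose weights on [a, a^-1, b, b^-1] are
   proportional to [1, 1, r, r]. *)
Definition step_law (R : realType) (r : R) (A : set basilica) : \bar R :=
  ((2 + 2 * r)^-1)%R%:E * (dirac gen_a A + dirac (gen_a^-1)%g A) +
  (r / (2 + 2 * r))%R%:E * (dirac gen_b A + dirac (gen_b^-1)%g A).

(* [s i] is the step taken at time [i + 1]. *)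
Definition walk (Omega : Type) (s : nat -> Omega -> basilica) (n : nat)
    (omega : Omega) : basilica :=
  (\prod_(0 <= i < n) s i omega)%g.

(* Main.v *)
Require Import Defs.
From mathcomp Require Import all_boot all_order all_algebra finmap.
From mathcomp Require Import all_classical all_reals all_analysis.
From mathcomp Require Import ring lra.
Import Order.TTheory GRing.Theory Num.Theory.
Import numFieldNormedType.Exports.

Set Implicit Arguments.
Unset Strict Implicit.
Unset Printing Implicit Defensive.

Local Open Scope classical_set_scope.
Local Open Scope ring_scope.

(** The walk contracts under taking sections, while a symmetric walk of
    positive speed cannot live on sets of subexponential size; the two facts
    together force zero speed.

    Contraction.  Each of the two first-level sections of the walk is, when
    watched only at the times at which it moves, again a walk on the same
    group of the same kind, with the ratio [r] replaced by [2 / r]; it moves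
    at the rate [section_rate r].  Going down two levels brings the ratio back
    to [r] and multiplies the total number of moves by
    (2 section_rate r) (2 section_rate (2 / r)) = 1/2.  Hence the lengths of
    the sections of Z_n at level 2k add up to about n / 2^k at most, in
    expectation: [drift_le_level].  The clock of the section walk is random
    and depends on the walk; instead of a renewal argument, [section_walk_le]
    guesses a potential and proves the bound by induction on n.

    Entropy.  An element is determined by its sections at level k and its
    action above them, so the number of elements whose level-k sections have
    total length L grows at most exponentially in L, at a rate that does not
    depend on k: [level_length_exp_summable].

    No speed without entropy.  The bound of Varopoulos and Carne,
    P(Z_n = g) <= 2 exp(e^2 n - e |g|), is [transition_prob_le].  With the
    previous item it bounds an exponential moment of e |Z_n| - 2 N(Z_n), where
    N is the sum of the section lengths, and Jensen's inequality gives
    e E|Z_n| <= 2 E N(Z_n) + e^2 n + const: [expected_length_le].  Taking k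
    large and e small, E|Z_n| = o(n): [expected_word_length_sublinear].

    Almost sure convergence.  Exponential moments of |Z_n| are
    submultiplicative in n, so the sublinear expectation improves to an
    exponentially small P(|Z_n| >= e n), in [tail_of_sublinear], and the
    Borel-Cantelli lemma concludes. *)

(** * Three elementary estimates *)

Lemma expR_le_quadratic (R : realType) (u : R) : 0 <= u <= 2^-1 -> expR u <= 1 + u + 2 * u ^+ 2.
Proof.
move=> /andP[u0 u1]; have := expR_ge1Dx (- u).
have u2 : 0 < 1 - u by lra.
rewrite expRN => H; have : expR u <= (1 - u)^-1.
  by rewrite -[leLHS]invrK lef_pV2 ?posrE ?invr_gt0 ?expR_gt0.
move/le_trans; apply; rewrite -[leLHS]mul1r ler_pdivrMr //; nra.
Qed.

Lemma expR2_gt4 (R : realType) : 4 < expR 2 :> R.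
Proof.
have -> : 2 = 4%:R * 2^-1 :> R by lra.
rewrite expRM_natl.
have h : 3 / 2 <= expR 2^-1 :> R by apply: le_trans (expR_ge1Dx _); lra.
have h0 : (0 : R) <= 3 / 2 by lra.
have : (3 / 2) ^+ 4 <= expR 2^-1 ^+ 4 :> R by rewrite lerXn2r ?nnegrE ?expR_ge0.
apply: lt_le_trans; rewrite !exprS expr0; lra.
Qed.

Lemma sum_geometric_le (R : realType) (x : R) n : 0 <= x < 1 ->
  \sum_(i < n) x ^+ i <= (1 - x)^-1.
Proof.
move=> /andP[x0 x1]; have x1' : 0 < 1 - x by rewrite subr_gt0.
rewrite -[leRHS]mul1r ler_pdivlMr // mulrC.
have -> : (1 - x) * \sum_(i < n) x ^+ i = 1 - x ^+ n.
  by rewrite -[RHS]opprB subrX1; ring.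
by rewrite gerBl exprn_ge0.
Qed.

(** * Sections of the elements of the Basilica group *)

Lemma basilica_ind (Q : basilica -> Prop) :
  Q 1%g -> (forall g s, s \in basilica_gens -> Q g -> Q (g * s)%g) ->
  forall g, Q g.
Proof.
move=> Q1 QM g; have [n /asboolP[w [wS _ <-]]] := has_word_ex g.
elim/last_ind: w wS => [|w s IH] wS; first by rewrite big_nil.
rewrite -cats1 big_cat big_seq1; apply: QM.
  by apply: wS; rewrite mem_rcons mem_head.
by apply: IH => t tw; apply: wS; rewrite mem_rcons inE tw orbT.
Qed.

Lemma basilicaP (g h : basilica) : (forall v, g v = h v) -> g = h.
Proof. by move=> gh; apply/val_inj/tree_autE. Qed.

Lemma basilica_actM (g h : basilica) v : (g * h)%g v = h (g v).
Proof. by []. Qed.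

Lemma basilica_actVK (g : basilica) v : (g^-1)%g (g v) = v.
Proof. by rewrite -basilica_actM mulgV. Qed.

Definition top_perm (g : basilica) (i : bool) : bool := head false (g [:: i]).

Definition splits (g : basilica) (i j : bool) (h : basilica) :=
  forall v, g (i :: v) = j :: h v.

(** The inverses are handled by the rule [V] because the inverse in the group
    of tree automorphisms is chosen, not computed. *)
Lemma splits_gen s i : s \in basilica_gens -> exists j h, splits s i j h.
Proof.
have V (t : basilica) i' j' (h : basilica) :
    splits t i' j' h -> splits (t^-1)%g j' i' (h^-1)%g.
  move=> th v; have := th ((h^-1)%g v).
  rewrite -(basilica_actM (h^-1)%g h) mulVg /= => <-.
  by rewrite basilica_actVK.
have a0 : splits gen_a false false 1%g by [].
have a1 : splits gen_a true true gen_b by [].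
have b0 : splits gen_b false true 1%g by [].
have b1 : splits gen_b true false gen_a by [].
rewrite !inE => /or4P[] /eqP->; case: i.
- by exists true, gen_b.
- by exists false, 1%g.
- by exists true, (gen_b^-1)%g; apply: V.
- by exists false, (1^-1)%g; apply: V.
- by exists false, gen_a.
- by exists true, 1%g.
- by exists false, (1^-1)%g; apply: V.
- by exists true, (gen_a^-1)%g; apply: V.
Qed.

Lemma splitsM (g g' : basilica) i j k h h' :
  splits g i j h -> splits g' j k h' -> splits (g * g')%g i k (h * h')%g.
Proof. by move=> gh gh' v; rewrite basilica_actM gh gh'. Qed.

(** Sections stay in the group because those of the generators do. *)
Lemma section_ex g i : exists h, splits g i (top_perm g i) h.
Proof.
suff [j [h gh]] : exists j h, splits g i j h.
  by exists h => v; rewrite /top_perm (gh [::]) gh.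
elim/basilica_ind: g i => [|g s sS IH] i; first by exists i, 1%g.
have [j [h gh]] := IH i; have [k [h' sh]] := splits_gen j sS.
by exists k, (h * h')%g; apply: splitsM gh sh.
Qed.

Definition section (i : bool) (g : basilica) : basilica :=
  sval (cid (section_ex g i)).

Lemma sectionP i g : splits g i (top_perm g i) (section i g).
Proof. exact: (svalP (cid (section_ex g i))). Qed.

Lemma splits_inv g i j h : splits g i j h -> top_perm g i = j /\ section i g = h.
Proof.
move=> gh; have e v : top_perm g i :: section i g v = j :: h v.
  by rewrite -sectionP gh.
by split; [have [] := e [::] | apply: basilicaP => v; have [] := e v].
Qed.

Lemma top_permM g h i : top_perm (g * h)%g i = top_perm h (top_perm g i).
Proof. by have [] := splits_inv (splitsM (sectionP i g) (sectionP _ h)). Qed.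

Lemma sectionM g h i :
  section i (g * h)%g = (section i g * section (top_perm g i) h)%g.
Proof. by have [] := splits_inv (splitsM (sectionP i g) (sectionP _ h)). Qed.

Lemma splits1 i : splits 1%g i i 1%g. Proof. by []. Qed.

Lemma top_perm1 i : top_perm 1%g i = i.
Proof. by have [] := splits_inv (splits1 i). Qed.

Lemma section1 i : section i 1%g = 1%g.
Proof. by have [] := splits_inv (splits1 i). Qed.

Lemma top_permV g i : top_perm (g^-1)%g (top_perm g i) = i.
Proof. by rewrite -top_permM mulgV top_perm1. Qed.

Lemma sectionV g i : section (top_perm g i) (g^-1)%g = ((section i g)^-1)%g.
Proof.
by apply/esym/mulg1_eq; rewrite -sectionM mulgV section1.
Qed.

Lemma top_perm_a i : top_perm gen_a i = i. Proof. by case: i. Qed.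

Lemma top_perm_b i : top_perm gen_b i = ~~ i. Proof. by case: i. Qed.

Lemma section_a i : section i gen_a = if i then gen_b else 1%g.
Proof.
have s : splits gen_a i i (if i then gen_b else 1%g) by case: i.
by have [_] := splits_inv s.
Qed.

Lemma section_b i : section i gen_b = if i then gen_a else 1%g.
Proof.
have s : splits gen_b i (~~ i) (if i then gen_a else 1%g) by case: i.
by have [_] := splits_inv s.
Qed.

Lemma top_perm_aV i : top_perm (gen_a^-1)%g i = i.
Proof. by rewrite -{1}(top_perm_a i) top_permV. Qed.

Lemma top_perm_bV i : top_perm (gen_b^-1)%g i = ~~ i.
Proof. by rewrite -{1}(negbK i) -(top_perm_b (~~ i)) top_permV. Qed.

Lemma section_aV i : section i (gen_a^-1)%g = if i then (gen_b^-1)%g else 1%g.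
Proof. by rewrite -{1}(top_perm_a i) sectionV section_a; case: i; rewrite ?invg1. Qed.

Lemma section_bV i : section i (gen_b^-1)%g = if i then 1%g else (gen_a^-1)%g.
Proof.
rewrite -{1}(negbK i) -(top_perm_b (~~ i)) sectionV section_b.
by case: i; rewrite ?invg1.
Qed.

Lemma top_permN g i : top_perm g (~~ i) = ~~ top_perm g i.
Proof.
elim/basilica_ind: g => [|g s]; first by rewrite !top_perm1.
by rewrite !top_permM !inE => /or4P[] /eqP-> ->;
  rewrite ?(top_perm_a, top_perm_b, top_perm_aV, top_perm_bV).
Qed.

(** The first-level portrait determines an element: this is what makes the
    counting of elements by their sections possible. *)
Lemma section_inj g h : (forall i, top_perm g i = top_perm h i) ->
  (forall i, section i g = section i h) -> g = h.
Proof.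
move=> tE sE; apply: basilicaP => -[|i v]; last by rewrite !sectionP tE sE.
by have [_ -> _] := tree_autP g; have [_ -> _] := tree_autP h.
Qed.

(** * Word length *)

Lemma word_length_le (w : seq basilica) : {subset w <= basilica_gens} ->
  (word_length (\prod_(s <- w) s)%g <= size w)%N.
Proof.
move=> wS; rewrite /word_length; case: ex_minnP => m _; apply.
by apply/asboolP; exists w.
Qed.

Lemma word_length_word g : exists w : seq basilica,
  [/\ {subset w <= basilica_gens}, size w = word_length g
    & (\prod_(s <- w) s)%g = g].
Proof. by rewrite /word_length; case: ex_minnP => m /asboolP. Qed.

Lemma word_lengthM g h :
  (word_length (g * h)%g <= word_length g + word_length h)%N.
Proof.
have [u [uS <- {1}<-]] := word_length_word g.
have [w [wS <- {1}<-]] := word_length_word h.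
rewrite -big_cat -size_cat; apply: word_length_le => s.
by rewrite mem_cat => /orP[/uS|/wS].
Qed.

Lemma word_length1 : word_length 1%g = 0%N.
Proof.
by apply/eqP; rewrite -leqn0; have := @word_length_le [::]; rewrite big_nil; apply.
Qed.

Lemma word_length_gen s : s \in basilica_gens -> (word_length s <= 1)%N.
Proof.
move=> sS; have := @word_length_le [:: s]; rewrite big_seq1; apply => t.
by rewrite inE => /eqP->.
Qed.

(** * Sums of finitely supported functions *)

Section FiniteSupport.
Variables (R : realType) (T : choiceType).
Implicit Types f h : T -> R.

Definition finsupp f := finite_set [set t | f t != 0].

Definition fsum f : R := \sum_(t \in [set: T]) f t.

Lemma finsuppS f h : finsupp f -> (forall t, f t = 0 -> h t = 0) -> finsupp h.
Proof.
move=> ff fh; apply: sub_finite_set ff => t /=.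
by apply: contra_neq; apply: fh.
Qed.

Lemma finsuppU f h k : finsupp f -> finsupp h ->
  (forall t, f t = 0 -> h t = 0 -> k t = 0) -> finsupp k.
Proof.
move=> ff hf fhk.
apply: (@sub_finite_set _ _ ([set t | f t != 0] `|` [set t | h t != 0])).
  move=> t /= kt; apply/orP; rewrite -negb_and.
  by apply: contra_neqN kt => /andP[/eqP f0 /eqP h0]; apply: fhk.
by rewrite finite_setU.
Qed.

Lemma finsupp_fsumD f h : finsupp f -> finsupp h ->
  fsum (fun t => f t + h t) = fsum f + fsum h.
Proof.
move=> ff hf; pose D := [set t | f t != 0] `|` [set t | h t != 0].
have Dfin : finite_set D by rewrite finite_setU.
have W (k : T -> R) : (forall t, f t = 0 -> h t = 0 -> k t = 0) ->
    \sum_(t \in [set: T]) k t = \sum_(t \in D) k t.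
  move=> K; rewrite (@fsbig_widen _ _ _ _ D setT) // => t [_ /=] /not_orP[].
  by move=> /negP /negPn /eqP f0 /negP /negPn /eqP h0; apply: K.
rewrite /fsum !W //; last by move=> t -> ->; rewrite addr0.
exact: fsbig_split.
Qed.

Lemma fsumTE (r : seq T) f : uniq r -> (forall t, t \notin r -> f t = 0) ->
  fsum f = \sum_(t <- r) f t.
Proof.
move=> ru f0; rewrite /fsum (fsbigE r) // => [|t _]; last exact: f0.
by apply: eq_bigl => t; rewrite in_setT.
Qed.

Lemma finsupp_le_fsum f t : finsupp f -> (forall u, 0 <= f u) ->
  f t <= fsum f.
Proof.
move=> /finite_seqP[S0 S0E] f0; pose S := undup (t :: S0).
rewrite (@fsumTE S) ?undup_uniq //.
  rewrite (bigD1_seq t) ?undup_uniq ?mem_undup ?mem_head //=.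
  by rewrite lerDl sumr_ge0.
move=> u; rewrite mem_undup inE negb_or => /andP[_].
by apply: contraNeq => fu; have : [set` S0] u by rewrite -S0E.
Qed.

Lemma eq_fsum f h : f =1 h -> fsum f = fsum h.
Proof. by move=> fh; apply: eq_fsbigr => t _. Qed.

Lemma fsumZ c f : fsum (fun t => c * f t) = c * fsum f.
Proof. by rewrite /fsum mulr_fsumr. Qed.

Lemma finsuppZ c f : finsupp f -> finsupp (fun t => c * f t).
Proof. by move=> ff; apply: finsuppS ff _ => t ->; rewrite mulr0. Qed.

Lemma finsupp_fsumB f h : finsupp f -> finsupp h ->
  fsum (fun t => f t - h t) = fsum f - fsum h.
Proof.
move=> ff hf; rewrite -[- fsum h]mulN1r -fsumZ -finsupp_fsumD ?finsuppZ //.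
  by apply: eq_fsum => t; rewrite mulN1r.
exact: finsuppZ.
Qed.

Lemma fsum_ge0 f : (forall t, 0 <= f t) -> 0 <= fsum f.
Proof. by move=> f0; apply: fsumr_ge0. Qed.

End FiniteSupport.

(** * Subadditive lengths *)

Section LengthLike.
Variables (G : groupType) (x y : G).

Definition sym_gens : seq G := [:: x; x^-1; y; y^-1]%g.

Lemma sym_gensV s : s \in sym_gens -> (s^-1)%g \in sym_gens.
Proof. by rewrite !inE => /or4P[] /eqP->; rewrite ?invgK eqxx ?orbT. Qed.

Lemma sym_gensP (Q : G -> Prop) : (forall s, s \in sym_gens -> Q s) ->
  [/\ Q x, Q x^-1%g, Q y & Q y^-1%g].
Proof. by move=> QS; split; apply: QS; rewrite !inE eqxx ?orbT. Qed.

(** What the word length and its sums over the sections at a level have in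
    common, and all that the contraction argument asks of a length. *)
Record length_like (N : G -> nat) : Prop := LengthLike {
  length_like1 : N 1%g = 0%N;
  length_likeM : forall g h, (N (g * h)%g <= N g + N h)%N;
  length_like_gen : forall s, s \in sym_gens -> (N s <= 1)%N }.

Lemma length_like_step N g s : length_like N -> s \in sym_gens ->
  (N (g * s)%g <= (N g).+1)%N.
Proof.
move=> NL sS; rewrite (leq_trans (length_likeM NL g s)) // -addn1 leq_add2l.
exact: length_like_gen.
Qed.

Lemma length_like_stepV N g s : length_like N -> s \in sym_gens ->
  (N g <= (N (g * s)%g).+1)%N.
Proof.
move=> NL sS; rewrite -{1}(mulgK s g); apply: length_like_step => //.
exact: sym_gensV.
Qed.

End LengthLike.

(** * The averaging operator of a symmetric walk *)

Section MarkovOperator.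
Variables (R : realType) (G : groupType) (x y : G) (p q : R).
Hypotheses (p0 : 0 <= p) (q0 : 0 <= q) (pq1 : p * 2 + q * 2 = 1).
Implicit Types f u : G -> R.

(** With steps x, x^-1 of probability p and y, y^-1 of probability q,
    [iter n markov f g] is the expectation of f(g Z_n).  All expectations of
    the walk are taken in this form, with no probability space. *)
Definition markov f (g : G) : R :=
  p * (f (g * x)%g + f (g * x^-1)%g) + q * (f (g * y)%g + f (g * y^-1)%g).

Lemma eq_iter_markov n f h : f =1 h -> iter n markov f =1 iter n markov h.
Proof.
by move=> fh; elim: n => //= n IH g; rewrite /markov !IH.
Qed.

Lemma iter_markov_le n f h : (forall g, f g <= h g) ->
  forall g, iter n markov f g <= iter n markov h g.
Proof.
move=> fh; elim: n => //= n IH g; rewrite /markov.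
by apply: lerD; apply: ler_wpM2l => //; apply: lerD.
Qed.

Lemma markov_ge_cst f g c :
  (forall s, s \in sym_gens x y -> c <= f (g * s)%g) -> c <= markov f g.
Proof.
move=> /sym_gensP[cx cX cy cY].
have -> : c = p * (c + c) + q * (c + c) by rewrite -[LHS]mul1r -pq1; ring.
by apply: lerD; apply: ler_wpM2l => //; apply: lerD.
Qed.

Lemma iter_markov_lin n f h a b g :
  iter n markov (fun g => a * f g + b * h g) g =
  a * iter n markov f g + b * iter n markov h g.
Proof. by elim: n g => //= n IH g; rewrite /markov !IH; ring. Qed.

Lemma iter_markov_cst n c g : iter n markov (fun _ => c) g = c.
Proof.
elim: n g => //= n IH g; rewrite /markov !IH -[RHS]mul1r -pq1; ring.
Qed.

(** Left translations commute with the right multiplications by steps. *)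
Lemma iter_markov_shift n f k g :
  iter n markov (fun g => f (k * g)%g) g = iter n markov f (k * g)%g.
Proof. by elim: n g => //= n IH g; rewrite /markov !IH !mulgA. Qed.

Lemma finsupp_shift f s : finsupp f -> finsupp (fun g => f (g * s)%g).
Proof.
rewrite /finsupp => ff.
have -> : [set g | f (g * s)%g != 0] = (fun g => (g * s^-1)%g) @` [set g | f g != 0].
  apply/seteqP; split=> [g /= fg|_ [g /= fg <-]]; last by rewrite mulgVK.
  by exists (g * s)%g; rewrite // mulgK.
exact: finite_image.
Qed.

Lemma finsupp_markov f : finsupp f -> finsupp (markov f).
Proof.
move=> ff; have ffs := finsupp_shift _ ff.
have fx : finsupp (fun g => p * (f (g * x)%g + f (g * x^-1)%g)).
  by apply: finsuppU (ffs x) (ffs x^-1%g) _ => g -> ->; rewrite addr0 mulr0.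
have fy : finsupp (fun g => q * (f (g * y)%g + f (g * y^-1)%g)).
  by apply: finsuppU (ffs y) (ffs y^-1%g) _ => g -> ->; rewrite addr0 mulr0.
by apply: finsuppU fx fy _ => g; rewrite /markov => -> ->; rewrite addr0.
Qed.

Lemma fsum_shift f s :
  fsum (fun g => f (g * s)%g) = fsum f.
Proof.
apply/esym/(@reindex_fsbigT _ _ _ _ _ (fun g => (g * s)%g)).
by exists (fun g => (g * s^-1)%g) => g; rewrite (mulgK, mulgVK).
Qed.

Lemma markov_fsum (F : G -> G -> R) : (forall s, finsupp (F s)) ->
  fsum (fun g => p * (F x g + F x^-1%g g) + q * (F y g + F y^-1%g g)) =
  p * (fsum (F x) + fsum (F x^-1%g)) + q * (fsum (F y) + fsum (F y^-1%g)).
Proof.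
move=> Ff; have FD s t : finsupp (fun g => F s g + F t g).
  by apply: finsuppU (Ff s) (Ff t) _ => g -> ->; rewrite addr0.
rewrite (finsupp_fsumD (finsuppZ p (FD x x^-1%g)) (finsuppZ q (FD y y^-1%g))).
by rewrite !fsumZ !finsupp_fsumD.
Qed.

(** Self-adjointness comes from the symmetry of the step distribution. *)
Lemma markov_adj f u : finsupp u ->
  fsum (fun g => markov f g * u g) = fsum (fun g => f g * markov u g).
Proof.
move=> uf; have ufs := finsupp_shift _ uf.
pose F1 s g := f (g * s)%g * u g; pose F2 s g := f g * u (g * s)%g.
have F1f s : finsupp (F1 s) by apply: finsuppS uf _ => g; rewrite /F1 => ->; rewrite mulr0.
have F2f s : finsupp (F2 s).
  by apply: finsuppS (ufs s) _ => g; rewrite /F2 => ->; rewrite mulr0.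
have F12 s : fsum (F1 s) = fsum (F2 s^-1%g).
  rewrite -(fsum_shift (F2 _) s); apply: eq_fsum => g.
  by rewrite /F2 mulgK.
transitivity (fsum (fun g =>
     p * (F1 x g + F1 x^-1%g g) + q * (F1 y g + F1 y^-1%g g))).
  by apply: eq_fsum => g; rewrite /markov /F1; ring.
transitivity (fsum (fun g =>
     p * (F2 x g + F2 x^-1%g g) + q * (F2 y g + F2 y^-1%g g))); last first.
  by apply: eq_fsum => g; rewrite /markov /F2; ring.
rewrite !markov_fsum // !F12 !invgK.
by congr (_ * _ + _ * _); rewrite addrC.
Qed.

(** Jensen's inequality for the square, with the variance written as a
    nonnegative combination of squares. *)
Lemma markov_sqr_le f g : markov f g ^+ 2 <= markov (fun g => f g ^+ 2) g.
Proof.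
rewrite /markov /=; move: (f (g * x)%g) (f (g * x^-1)%g) (f (g * y)%g) (f (g * y^-1)%g) => a b c d.
rewrite -subr_ge0.
have -> : p * (a ^+ 2 + b ^+ 2) + q * (c ^+ 2 + d ^+ 2) -
    (p * (a + b) + q * (c + d)) ^+ 2 =
    p * p * (a - b) ^+ 2 + q * q * (c - d) ^+ 2 + p * q *
    ((a - c) ^+ 2 + (a - d) ^+ 2 + (b - c) ^+ 2 + (b - d) ^+ 2).
  have -> : p * (a ^+ 2 + b ^+ 2) + q * (c ^+ 2 + d ^+ 2) =
    (p * 2 + q * 2) * (p * (a ^+ 2 + b ^+ 2) + q * (c ^+ 2 + d ^+ 2)).
    by rewrite pq1 mul1r.
  ring.
by repeat (apply: sqr_ge0 || assumption || apply: addr_ge0 || apply: mulr_ge0).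
Qed.

(** Averaging the squares does not change their sum, so Jensen's inequality
    makes [markov] a contraction in the l2 norm. *)
Lemma markov_contraction u : finsupp u ->
  fsum (fun g => markov u g ^+ 2) <= fsum (fun g => u g ^+ 2).
Proof.
move=> uf; have uf2 : finsupp (fun g => u g ^+ 2).
  by apply: finsuppS uf _ => g ->; rewrite expr0n.
have muf2 := finsupp_markov uf2.
have -> : fsum (fun g => u g ^+ 2) = fsum (markov (fun g => u g ^+ 2)).
  rewrite (@markov_fsum (fun s g => u (g * s)%g ^+ 2)); last first.
    by move=> s; exact: (@finsupp_shift (fun g => u g ^+ 2)).
  rewrite !(fsum_shift (fun g => u g ^+ 2)) -[LHS]mul1r -pq1.
  by move: (fsum _) => S; ring.
rewrite -subr_ge0 -finsupp_fsumB //; last first.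
  by apply: finsuppS (finsupp_markov uf) _ => g ->; rewrite expr0n.
by apply: fsum_ge0 => g; rewrite subr_ge0 markov_sqr_le.
Qed.

Lemma iter_markov_adj n f u : finsupp u ->
  fsum (fun g => iter n markov f g * u g) =
  fsum (fun g => f g * iter n markov u g).
Proof.
elim: n u => //= n IH u uf.
rewrite markov_adj // IH; last exact: finsupp_markov.
by apply: eq_fsum => g; rewrite -iterSr.
Qed.

Definition unit_mass : G -> R := fun g => (g == 1%g)%:R.

Lemma finsupp_unit_mass : finsupp unit_mass.
Proof.
apply: (@sub_finite_set _ _ [set 1%g]) => [|//] => g /=.
by rewrite /unit_mass pnatr_eq0 eqb0 negbK => /eqP.
Qed.

Lemma finsupp_iter_markov n u : finsupp u -> finsupp (iter n markov u).
Proof. by move=> uf; elim: n => //= n; apply: finsupp_markov. Qed.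

(** By symmetry [iter n markov unit_mass g] is also the probability that
    Z_n = g, and the right-hand side is the sum of f against the law of Z_n. *)
Lemma iter_markov1E n f :
  iter n markov f 1%g = fsum (fun g => f g * iter n markov unit_mass g).
Proof.
rewrite -iter_markov_adj; last exact: finsupp_unit_mass.
rewrite (@fsumTE _ _ [:: 1%g]) //.
  by rewrite big_seq1 /unit_mass eqxx mulr1.
by move=> g; rewrite inE /unit_mass => /negbTE->; rewrite mulr0.
Qed.

(** * Chebyshev polynomials of the averaging operator *)

(** The components are T_j(P) and U_(j-1)(P) applied to the unit mass, for P
    the averaging operator and T, U the Chebyshev polynomials.  The recursion
    is the addition formula of cosine and sine:
    T_(j+1) = X T_j + (X^2 - 1) U_(j-1) and U_j = X U_(j-1) + T_j. *)
Fixpoint cheb (j : nat) : (G -> R) * (G -> R) :=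
  if j is j'.+1 then
    let: (t, w) := cheb j' in
    (fun g => markov t g + (markov (markov w) g - w g),
     fun g => markov w g + t g)
  else (unit_mass, fun _ => 0).

Lemma chebS j : cheb j.+1 =
  (fun g => markov (cheb j).1 g + (markov (markov (cheb j).2) g - (cheb j).2 g),
   fun g => markov (cheb j).2 g + (cheb j).1 g).
Proof. by rewrite /=; case: (cheb j). Qed.

Lemma finsupp_cheb j : finsupp (cheb j).1 /\ finsupp (cheb j).2.
Proof.
elim: j => [|j [tf wf]].
  split; first exact: finsupp_unit_mass.
  by apply: finsuppS finsupp_unit_mass _.
rewrite chebS /=; split; last first.
  by apply: finsuppU (finsupp_markov wf) tf _ => g -> ->; rewrite addr0.
have vf : finsupp (fun g => markov (markov (cheb j).2) g - (cheb j).2 g).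
  apply: finsuppU (finsupp_markov (finsupp_markov wf)) wf _ => g -> ->.
  by rewrite subrr.
by apply: finsuppU (finsupp_markov tf) vf _ => g -> ->; rewrite addr0.
Qed.

(** 2 X T_(j+1) = T_(j+2) + T_j: a step of the walk is a step of the simple
    random walk on the index of the Chebyshev polynomials. *)
Lemma markov_cheb j g :
  markov (cheb j.+1).1 g = 2^-1 * ((cheb j.+2).1 g + (cheb j).1 g).
Proof.
rewrite [cheb j.+2]chebS [cheb j.+1]chebS /=.
move: (cheb j) => [t w] /=; rewrite /markov.
by field.
Qed.

(** This is Pell's equation T_j^2 + (1 - X^2) U_(j-1)^2 = 1, read as a
    conserved quadratic form.  It bounds T_j(P) without the spectral
    theorem. *)
Lemma cheb_energy j :
  fsum (fun g => (cheb j).1 g ^+ 2 +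
    ((cheb j).2 g ^+ 2 - markov (cheb j).2 g ^+ 2)) = 1.
Proof.
elim: j => [|j IH].
  rewrite (@fsumTE _ _ [:: 1%g]) //.
    rewrite big_seq1 /= /unit_mass eqxx /markov /=; ring.
  move=> g; rewrite inE /= /unit_mass /markov => /negbTE-> /=; ring.
have [tf wf] := finsupp_cheb j.
rewrite -[RHS]IH chebS /=; move: (cheb j) tf wf => [t w] /= tf wf {IH}.
have [Ptf Pwf] := (finsupp_markov tf, finsupp_markov wf).
have E g : markov (fun g => markov w g + t g) g = markov (markov w) g + markov t g.
  by rewrite /markov; ring.
(* The new energy density is e1 + e2 + e3, and e2, e3 sum to zero because
   the averaging operator is self-adjoint. *)
pose e1 g := t g ^+ 2 + (w g ^+ 2 - markov w g ^+ 2).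
pose e2 g := 2 * (t g * markov w g - markov t g * w g).
pose e3 g := 2 * (markov w g * markov w g - markov (markov w) g * w g).
have e1f : finsupp e1.
  have vf : finsupp (fun g => w g ^+ 2 - markov w g ^+ 2).
    by apply: finsuppU wf Pwf _ => g -> ->; rewrite subrr.
  by apply: finsuppU tf vf _ => g; rewrite /e1 => -> ->; rewrite expr0n addr0.
have e2f : finsupp e2.
  by apply: finsuppU wf tf _ => g; rewrite /e2 => -> ->; rewrite mul0r mulr0 subrr mulr0.
have e3f : finsupp e3.
  by apply: finsuppU wf Pwf _ => g; rewrite /e3 => -> ->; rewrite mul0r mulr0 subrr mulr0.
have S2 : fsum e2 = 0.
  rewrite /e2 fsumZ finsupp_fsumB; last 2 first.
  - by apply: finsuppS tf _ => g ->; rewrite mul0r.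
  - by apply: finsuppS wf _ => g ->; rewrite mulr0.
  by rewrite (markov_adj t wf) subrr mulr0.
have S3 : fsum e3 = 0.
  rewrite /e3 fsumZ finsupp_fsumB; last 2 first.
  - by apply: finsuppS Pwf _ => g ->; rewrite mul0r.
  - by apply: finsuppS wf _ => g ->; rewrite mulr0.
  by rewrite (markov_adj (markov w) wf) subrr mulr0.
have e12f : finsupp (fun g => e1 g + e2 g).
  by apply: finsuppU e1f e2f _ => g -> ->; rewrite addr0.
transitivity (fsum (fun g => e1 g + e2 g + e3 g)); last first.
  by rewrite finsupp_fsumD // finsupp_fsumD // S2 S3 !addr0.
by apply: eq_fsum => g; rewrite E /e1 /e2 /e3; ring.
Qed.

(** In the conserved energy the term of U is nonnegative since P contracts,
    so the l2 norm of T_j(P) on the unit mass is at most 1. *)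
Lemma cheb_le1 j g : `|(cheb j).1 g| <= 1.
Proof.
have [tf wf] := finsupp_cheb j; have Pwf := finsupp_markov wf.
have t2f : finsupp (fun g => (cheb j).1 g ^+ 2).
  by apply: finsuppS tf _ => h ->; rewrite expr0n.
have w2f : finsupp (fun g => (cheb j).2 g ^+ 2).
  by apply: finsuppS wf _ => h ->; rewrite expr0n.
have Pw2f : finsupp (fun g => markov (cheb j).2 g ^+ 2).
  by apply: finsuppS Pwf _ => h ->; rewrite expr0n.
have := cheb_energy j; rewrite finsupp_fsumD //; last first.
  by apply: finsuppU w2f Pw2f _ => h -> ->; rewrite subrr.
rewrite (finsupp_fsumB w2f Pw2f) => E.
have D := markov_contraction wf.
have F := finsupp_le_fsum g t2f (fun k => sqr_ge0 _).
rewrite -(@ler_pXn2r _ 2) ?nnegrE ?normr_ge0 // expr1n real_normK ?num_real //.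
move: D E F; move: (fsum _) (fsum _) (fsum _) (_ ^+ 2) => *; lra.
Qed.

Variable ell : G -> nat.
Hypothesis ellL : length_like x y ell.

(** * The bound of Varopoulos and Carne *)

Lemma markov_supp (f : G -> R) k g : (forall g, (k <= ell g)%N -> f g = 0) ->
  (k < ell g)%N -> markov f g = 0.
Proof.
move=> f0 kg.
have H s : s \in sym_gens x y -> f (g * s)%g = 0.
  move=> sS; apply: f0; rewrite -ltnS (leq_trans kg) //; exact: length_like_stepV sS.
by rewrite /markov !H ?inE ?eqxx ?orbT // !addr0 !mulr0 addr0.
Qed.

(** Speed of propagation one: the polynomials have degrees j and j - 1. *)
Lemma cheb_supp j :
  (forall g, (j < ell g)%N -> (cheb j).1 g = 0) /\
  (forall g, (j <= ell g)%N -> (cheb j).2 g = 0).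
Proof.
elim: j => [|j [t0 w0]].
  split=> // g; rewrite /= /unit_mass; case: eqVneq => // ->.
  by rewrite (length_like1 ellL).
rewrite chebS /=; split=> g jg; last first.
  by rewrite t0 // addr0; apply: markov_supp jg.
have jg' : (j <= ell g)%N by apply: leq_trans jg; rewrite leqW.
rewrite (@markov_supp _ j.+1 g t0 jg) (w0 g jg') subr0 add0r.
by apply: (@markov_supp _ j.+1 g _ jg) => h; apply: markov_supp w0.
Qed.

(** Let S be the simple random walk on the integers started at k.  Expanding
    P^n T_k in Chebyshev polynomials, P^n T_k is the expectation of T_|S_n|,
    and only |S_n| >= |g| contributes at g.  The right-hand side bounds this
    probability through E (z^-S_n + z^S_n) = (z^-k + z^k) ((z^-1 + z)/2)^n. *)
Lemma iter_cheb_le (z : R) n k g : 0 < z <= 1 ->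
  `|iter n markov (cheb k).1 g| <=
  z ^+ ell g * (z ^- k + z ^+ k) * ((z^-1 + z) / 2) ^+ n.
Proof.
move=> /andP[z0 z1]; have zi0 : 0 < z^-1 by rewrite invr_gt0.
elim: n k g => [|n IH] k g.
  rewrite expr0 mulr1 /=; case: (ltnP k (ell g)) => kg.
    by rewrite (cheb_supp k).1 // normr0 mulr_ge0 ?addr_ge0 ?exprn_ge0 ?invr_ge0 ?exprn_ge0 // ltW.
  apply: le_trans (cheb_le1 k g) _ => //.
  rewrite mulrDr; apply: ler_wpDr; first by rewrite mulr_ge0 // exprn_ge0 // ltW.
  by rewrite ler_pdivlMr ?exprn_gt0 // mul1r ler_wiXn2l // ltW.
rewrite iterSr; case: k => [|k].
  (* At k = 0 the walk on the index is reflected: X T_0 = T_1. *)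
  rewrite (@eq_iter_markov n _ (cheb 1).1); last first.
    by move=> h; rewrite /= /markov; ring.
  apply: le_trans (IH 1%N g) _; rewrite expr1 expr0 invr1 [in leRHS]exprS le_eqVlt.
  apply/orP; left; apply/eqP; move: (_ ^+ n) => M.
  by field; apply: lt0r_neq0.
rewrite (@eq_iter_markov n _
  (fun h => 2^-1 * (cheb k.+2).1 h + 2^-1 * (cheb k).1 h)); last first.
  by move=> h; rewrite markov_cheb mulrDr.
rewrite iter_markov_lin (le_trans (ler_normD _ _)) // !normrM ger0_norm ?invr_ge0 //.
apply: le_trans (lerD (ler_wpM2l _ (IH k.+2 g)) (ler_wpM2l _ (IH k g))) _; rewrite ?invr_ge0 //.
rewrite le_eqVlt; apply/orP; left; apply/eqP.
rewrite [(_ / 2) ^+ n.+1]exprS; move: (_ ^+ n) (z ^+ ell g) => A B.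
rewrite -!exprVn !exprS; move: (z ^+ k) (z^-1 ^+ k) => C D.
by field; apply: lt0r_neq0.
Qed.

(** [iter_cheb_le] at k = 0 and z = 1 - e, a rational stand-in for exp(- e)
    that keeps the average of z and z^-1 below 1 + e^2. *)
Lemma transition_prob_le (e : R) n g : 0 <= e <= 2^-1 ->
  `|iter n markov unit_mass g| <= 2 * expR (e ^+ 2 * n%:R - e * (ell g)%:R).
Proof.
move=> /andP[e0 e1]; have z : 0 < 1 - e <= 1 by apply/andP; split; lra.
have z0 : 0 < 1 - e by lra.
apply: le_trans (iter_cheb_le n 0 g z) _.
rewrite expr0 invr1 (_ : 1 + 1 = 2) // [_ * 2]mulrC -mulrA ler_pM2l //.
rewrite expRD mulrC -mulNr !expRM_natr ler_pM ?exprn_ge0 //.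
- by rewrite divr_ge0 // addr_ge0 ?invr_ge0 // ltW.
- by rewrite ltW.
- rewrite lerXn2r ?nnegrE ?expR_ge0 //.
    by rewrite divr_ge0 // addr_ge0 ?invr_ge0 // ltW.
  apply: le_trans (expR_ge1Dx _).
  have -> : (((1 - e)^-1 + (1 - e)) / 2) = 1 + e ^+ 2 / (2 * (1 - e)).
    by field; apply: lt0r_neq0.
  rewrite lerD2l ler_pdivrMr ?mulr_gt0 // ler_peMr ?sqr_ge0 //; lra.
- rewrite lerXn2r ?nnegrE ?expR_ge0 ?(ltW z0) //.
  by have := expR_ge1Dx (- e).
Qed.

Lemma iter_markov_ge0 n (f : G -> R) g : (forall h, 0 <= f h) -> 0 <= iter n markov f g.
Proof.
by move=> f0; rewrite -(iter_markov_cst n 0 g); apply: iter_markov_le.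
Qed.

(** * Speed is bounded by entropy *)

(** The factor exp(e |g|) cancels against the bound on P(Z_n = g), and the
    remaining factor is summable. *)
Lemma expected_exp_le (e A : R) (V : G -> R) n : 0 <= e <= 2^-1 ->
  (forall S : seq G, uniq S -> \sum_(g <- S) expR (- V g) <= A) ->
  iter n markov (fun g => expR (e * (ell g)%:R - V g)) 1%g <=
  2 * A * expR (e ^+ 2 * n%:R).
Proof.
move=> e01 VA; rewrite iter_markov1E.
have /finite_seqP[S SE] : finsupp (iter n markov unit_mass).
  by apply: finsupp_iter_markov; apply: finsupp_unit_mass.
rewrite (@fsumTE _ _ (undup S)) ?undup_uniq //; last first.
  move=> g; rewrite mem_undup; case: (eqVneq (iter n markov unit_mass g) 0).
    by move=> ->; rewrite mulr0.
  by move=> gN0 gS; exfalso; move/negP: gS; apply; have : [set` S] g by rewrite -SE.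
apply: (@le_trans _ _ (\sum_(g <- undup S) 2 * expR (e ^+ 2 * n%:R) * expR (- V g))).
  apply: ler_sum => g _.
  apply: le_trans (ler_wpM2l (expR_ge0 _) (le_trans (ler_norm _) (transition_prob_le n g e01))) _.
  rewrite mulrCA -expRD -[leRHS]mulrA -expRD le_eqVlt; apply/orP; left.
  by apply/eqP; congr (_ * expR _); ring.
rewrite -mulr_sumr; apply: le_trans (ler_wpM2l _ (VA _ (undup_uniq _))) _.
  by rewrite mulr_ge0 ?expR_ge0.
by rewrite mulrAC.
Qed.

(** Think of V as a code length.  The conclusion is the inequality of
    speed and entropy, with the entropy of Z_n replaced by the larger expected
    code length; it follows from [expected_exp_le] by Jensen's inequality for
    the exponential, in the tangent-line form 1 + u <= exp u. *)
Lemma expected_length_le (e A : R) (V : G -> R) n : 0 <= e <= 2^-1 -> 0 < A ->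
  (forall S : seq G, uniq S -> \sum_(g <- S) expR (- V g) <= A) ->
  e * iter n markov (fun g => (ell g)%:R) 1%g <=
  iter n markov V 1%g + e ^+ 2 * n%:R + ln (2 * A).
Proof.
move=> e01 A0 VA; pose c := e ^+ 2 * n%:R + ln (2 * A).
have cE : expR c = 2 * A * expR (e ^+ 2 * n%:R).
  by rewrite expRD lnK ?posrE ?mulr_gt0 // mulrC.
have := expected_exp_le n e01 VA; rewrite -cE.
have -> : iter n markov (fun g => expR (e * (ell g)%:R - V g)) 1%g =
    expR c * iter n markov (fun g => expR (e * (ell g)%:R - V g - c)) 1%g.
  rewrite -[RHS]addr0 -[X in _ + X](mul0r (iter n markov (fun _ => 0) 1%g)).
  rewrite -iter_markov_lin; apply: eq_iter_markov => g.
  by rewrite -expRD mul0r addr0; congr expR; ring.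
rewrite -[leRHS]mulr1 ler_pM2l ?expR_gt0 // => E1.
have : iter n markov (fun g => 1 + (e * (ell g)%:R - V g - c)) 1%g <= 1.
  by apply: le_trans E1; apply: iter_markov_le => // g; apply: expR_ge1Dx.
have -> : iter n markov (fun g => 1 + (e * (ell g)%:R - V g - c)) 1%g =
    1 * iter n markov (fun g => e * (ell g)%:R + (- 1) * V g) 1%g +
    1 * iter n markov (fun _ => 1 - c) 1%g.
  by rewrite -iter_markov_lin; apply: eq_iter_markov => g; ring.
rewrite iter_markov_lin iter_markov_cst // /c; lra.
Qed.

(** * Exponential moments of the length *)

Lemma iter_markov_le_ball n (f h : G -> R) g :
  (forall k, (ell k <= ell g + n)%N -> f k <= h k) ->
  iter n markov f g <= iter n markov h g.
Proof.
elim: n g => [|n IH] g fh /=; first by apply: fh; rewrite addn0.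
have H s : s \in sym_gens x y ->
    iter n markov f (g * s)%g <= iter n markov h (g * s)%g.
  move=> sS; apply: IH => k kn; apply: fh; apply: leq_trans kn _.
  by rewrite -addSnnS leq_add2r (length_like_step g ellL).
by apply: lerD; apply: ler_wpM2l => //; apply: lerD; apply: H; rewrite !inE eqxx ?orbT.
Qed.

Lemma expected_length_le_time n : iter n markov (fun g => (ell g)%:R) 1%g <= n%:R.
Proof.
rewrite -(iter_markov_cst n n%:R 1%g); apply: iter_markov_le_ball => k.
by rewrite (length_like1 ellL) add0n ler_nat.
Qed.

Lemma expected_length_shift_le n g :
  iter n markov (fun g => (ell g)%:R) g <=
  (ell g)%:R + iter n markov (fun g => (ell g)%:R) 1%g.
Proof.
rewrite -{1}(mulg1 g) -iter_markov_shift.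
have -> : (ell g)%:R + iter n markov (fun g => (ell g)%:R) 1%g =
    1 * iter n markov (fun=> (ell g)%:R) 1%g + 1 * iter n markov (fun g => (ell g)%:R) 1%g.
  by rewrite !mul1r iter_markov_cst.
rewrite -iter_markov_lin; apply: iter_markov_le => // h.
by rewrite !mul1r -natrD ler_nat (length_likeM ellL).
Qed.

Lemma exp_moment_shift_le (t : R) n g : 0 <= t ->
  iter n markov (fun g => expR (t * (ell g)%:R)) g <=
  expR (t * (ell g)%:R) * iter n markov (fun g => expR (t * (ell g)%:R)) 1%g.
Proof.
move=> t0; rewrite -{1}(mulg1 g) -iter_markov_shift -[leRHS]addr0.
rewrite -[X in _ + X](mul0r (iter n markov (fun _ => 0) 1%g)) -iter_markov_lin.
apply: iter_markov_le => // h; rewrite mul0r addr0 -expRD ler_expR -mulrDr.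
by rewrite ler_wpM2l // -natrD ler_nat (length_likeM ellL).
Qed.

Lemma exp_momentD (t : R) m n : 0 <= t ->
  iter (m + n) markov (fun g => expR (t * (ell g)%:R)) 1%g <=
  iter m markov (fun g => expR (t * (ell g)%:R)) 1%g *
  iter n markov (fun g => expR (t * (ell g)%:R)) 1%g.
Proof.
move=> t0; rewrite iterD mulrC -[leRHS]addr0.
rewrite -[X in _ + X](mul0r (iter m markov (fun _ => 0) 1%g)) -iter_markov_lin.
apply: iter_markov_le => // h; rewrite mul0r addr0 mulrC.
exact: exp_moment_shift_le.
Qed.

Lemma exp_moment_le_time (t : R) n : 0 <= t ->
  iter n markov (fun g => expR (t * (ell g)%:R)) 1%g <= expR (t * n%:R).
Proof.
move=> t0; rewrite -(iter_markov_cst n (expR (t * n%:R)) 1%g).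
apply: iter_markov_le_ball => k; rewrite (length_like1 ellL) add0n => kn.
by rewrite ler_expR ler_wpM2l // ler_nat.
Qed.

Lemma exp_moment_mul (t : R) m j : 0 <= t ->
  iter (j * m) markov (fun g => expR (t * (ell g)%:R)) 1%g <=
  iter m markov (fun g => expR (t * (ell g)%:R)) 1%g ^+ j.
Proof.
move=> t0; elim: j => [|j IH].
  by rewrite mul0n expr0 /= (length_like1 ellL) mulr0 expR0.
rewrite mulSn exprS; apply: le_trans (exp_momentD _ _ t0) _.
by apply: ler_wpM2l => //; apply: iter_markov_ge0 => h; apply: expR_ge0.
Qed.

(** Fix a time m at which the expected length is at most (e/2) m.  For a small
    enough t the exponential moment at time m is at most exp((3/4) e t m), and
    submultiplicativity spreads this rate to all times, so that Markov's
    inequality leaves the exponent - (1/4) e t n. *)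
Lemma tail_of_sublinear (e : R) : 0 < e ->
  (forall d : R, 0 < d -> exists K : R, forall n,
     iter n markov (fun g => (ell g)%:R) 1%g <= d * n%:R + K) ->
  exists C k : R, 0 < k /\ forall n,
    iter n markov (fun g => (e * n%:R <= (ell g)%:R)%R%:R) 1%g <= C * expR (- (k * n%:R)).
Proof.
move=> e0 sub; have [K HK] := sub (e / 4) ltac:(by rewrite divr_gt0).
have [m m0 Em] : exists2 m, (0 < m)%N &
    iter m markov (fun g => (ell g)%:R) 1%g <= e / 2 * m%:R.
  have [M HM] : exists M, K / (e / 4) < M%:R.
    by exists (Num.truncn (K / (e / 4))).+1; apply: Num.Theory.truncnS_gt.
  exists M.+1 => //; apply: le_trans (HK _) _.
  move: HM; rewrite ltr_pdivrMr ?divr_gt0 // => HM.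
  rewrite -[M.+1]addn1 natrD; nra.
have mR0 : 0 < m%:R :> R by rewrite ltr0n.
(* u is the largest value of t |g| within m steps: at most 1/2 for
   [expR_le_quadratic], at most e / 8 to absorb its quadratic term. *)
pose u := Num.min 2^-1 (e / 8); pose t := u / m%:R.
have u0 : 0 < u by rewrite /u lt_min invr_gt0 ltr0n divr_gt0.
have [u1 u2] : u <= 2^-1 /\ u <= e / 8 by rewrite /u !ge_min !lexx; split=> //; rewrite orbT.
have t0 : 0 < t by rewrite divr_gt0.
have tm : t * m%:R = u by rewrite divfK // lt0r_neq0.
pose f g := expR (t * (ell g)%:R).
have fm : iter m markov f 1%g <= expR (3 / 4 * e * u).
  apply: le_trans (expR_ge1Dx _).
  apply: (@le_trans _ _ (iter m markov (fun g =>
     t * (ell g)%:R + 1 * (1 + 2 * u ^+ 2)) 1%g)).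
    apply: iter_markov_le_ball => g; rewrite (length_like1 ellL) add0n => gm.
    have tg : t * (ell g)%:R <= u by rewrite -tm ler_wpM2l ?ler_nat // ltW.
    have tg0 : 0 <= t * (ell g)%:R by rewrite mulr_ge0 // ltW.
    apply: le_trans (expR_le_quadratic _) _; first by rewrite tg0 (le_trans tg).
    nra.
  rewrite iter_markov_lin iter_markov_cst //.
  have : t * iter m markov (fun g => (ell g)%:R) 1%g <= t * (e / 2 * m%:R).
    by rewrite ler_wpM2l // ltW.
  have -> : t * (e / 2 * m%:R) = e / 2 * u by rewrite -tm; ring.
  nra.
exists (expR u), (e / 4 * t); split; first by rewrite !mulr_gt0 ?invr_gt0.
move=> n; apply: (@le_trans _ _ (iter n markov (fun g =>
    expR (- (t * e * n%:R)) * f g + 0 * f g) 1%g)).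
  apply: iter_markov_le => // g; rewrite mul0r addr0 /f -expRD.
  case: (leP (e * n%:R) (ell g)%:R) => /= eg; last exact: expR_ge0.
  by rewrite -[leLHS]expR0 ler_expR addrC subr_ge0 -mulrA ler_wpM2l // ltW.
rewrite iter_markov_lin mul0r addr0.
have fn : iter n markov f 1%g <= expR (3 / 4 * e * t * n%:R) * expR u.
  rewrite {1}(divn_eq n m); apply: le_trans (exp_momentD _ _ (ltW t0)) _.
  apply: ler_pM; try by apply: iter_markov_ge0 => h; apply: expR_ge0.
    apply: le_trans (exp_moment_mul _ _ (ltW t0)) _.
    apply: le_trans (lerXn2r _ _ _ fm) _; rewrite ?nnegrE ?expR_ge0 //.
      by apply: iter_markov_ge0 => h; apply: expR_ge0.
    rewrite -expRM_natl ler_expR -tm.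
    have -> : (n %/ m)%:R * (3 / 4 * e * (t * m%:R)) = 3 / 4 * e * t * (n %/ m * m)%:R.
      by rewrite natrM; ring.
    by rewrite ler_wpM2l ?ler_nat ?leq_divM // !mulr_ge0 ?invr_ge0 // ltW.
  apply: le_trans (exp_moment_le_time _ (ltW t0)) _.
  by rewrite ler_expR -tm ler_wpM2l ?ler_nat ?(ltnW (ltn_pmod _ _)) // ltW.
apply: le_trans (ler_wpM2l (expR_ge0 _) fn) _.
by rewrite -!expRD ler_expR le_eqVlt; apply/orP; left; apply/eqP; field.
Qed.

End MarkovOperator.

(** * Lengths of sections at a level *)

Lemma word_length_like : length_like gen_a gen_b word_length.
Proof.
split; [exact: word_length1|exact: word_lengthM|exact: word_length_gen].
Qed.

Definition split_length (N : basilica -> nat) (g : basilica) : nat :=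
  N (section false g) + N (section true g).

(** Subadditivity: in a product the sections of the second factor are
    permuted by the first.  At most one section of a generator is nontrivial,
    and it is a generator. *)
Lemma split_length_like N : length_like gen_a gen_b N ->
  length_like gen_a gen_b (split_length N).
Proof.
move=> NL; split.
- by rewrite /split_length !section1 (length_like1 NL).
- move=> g h; rewrite /split_length !sectionM.
  have -> : (N (section false h) + N (section true h) =
      N (section (top_perm g false) h) + N (section (top_perm g true) h))%N.
    rewrite (top_permN g false : top_perm g true = _).
    by case: (top_perm g false) => //; rewrite addnC.
  by rewrite addnACA leq_add // (length_likeM NL).
- have N1 := length_like1 NL; have Ng := length_like_gen NL.
  move=> s; rewrite /split_length !inE => /or4P[] /eqP->;
  rewrite ?(section_a, section_aV, section_b, section_bV) N1 ?add0n ?addn0;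
  by apply: Ng; rewrite !inE eqxx ?orbT.
Qed.

Definition level_length (k : nat) : basilica -> nat :=
  iter k split_length word_length.

Lemma level_length_like k : length_like gen_a gen_b (level_length k).
Proof.
by elim: k => [|k]; [exact: word_length_like | exact: split_length_like].
Qed.

Section Growth.
Variable R : realType.

Lemma ler_sum_uniq (T : eqType) (F : T -> R) (S L : seq T) :
  (forall t, 0 <= F t) -> uniq S -> {subset S <= L} ->
  \sum_(t <- S) F t <= \sum_(t <- L) F t.
Proof.
move=> F0; elim: S L => [|t S IH] L /=; first by rewrite big_nil sumr_ge0.
move=> /andP[tS uS] SL; have tL : t \in L by rewrite SL ?mem_head.
rewrite (perm_big _ (perm_to_rem tL)) !big_cons lerD2l IH // => u uS'.
have := SL u; rewrite (perm_mem (perm_to_rem tL)) !inE uS' orbT => /(_ isT).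
by case: eqVneq uS' tS => // -> ->.
Qed.

Lemma ler_sum_inj (T U : eqType) (f : T -> U) (F : U -> R) (S : seq T) (L : seq U) :
  (forall u, 0 <= F u) -> injective f -> uniq S -> {subset map f S <= L} ->
  \sum_(t <- S) F (f t) <= \sum_(u <- L) F u.
Proof.
move=> F0 fI uS SL; rewrite -(big_map f xpredT F).
by apply: ler_sum_uniq => //; rewrite map_inj_uniq.
Qed.

(** The factor 2 makes the word length summable, as exp(2) exceeds the number
    of generators. *)
Definition exp_summable (N : basilica -> nat) :=
  exists2 A : R, 0 < A & forall S : seq basilica, uniq S ->
    \sum_(g <- S) expR (- (2 * (N g)%:R)) <= A.

(** A list with repetitions that covers the sphere of radius n. *)
Fixpoint word_products (n : nat) : seq basilica :=
  if n is n'.+1 then [seq (s * g)%g | s <- basilica_gens, g <- word_products n']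
  else [:: 1%g].

Lemma size_word_products n : size (word_products n) = (4 ^ n)%N.
Proof. by elim: n => // n IH; rewrite size_allpairs IH expnS. Qed.

Lemma mem_word_products g : g \in word_products (word_length g).
Proof.
have [w [wS <- <-]] := word_length_word g.
elim: w wS => [|s w IH] wS; first by rewrite big_nil inE.
rewrite big_cons; apply/allpairsP; exists (s, (\prod_(t <- w) t)%g); split=> //=.
  by apply: wS; rewrite mem_head.
by apply: IH => t tw; apply: wS; rewrite inE tw orbT.
Qed.

Lemma word_length_exp_summable : exp_summable word_length.
Proof.
pose x : R := 4 * expR (- 2).
have x0 : 0 <= x by rewrite mulr_ge0 ?expR_ge0.
have x1 : x < 1 by rewrite /x expRN ltr_pdivrMr ?expR_gt0 // mul1r expR2_gt4.
have x1' : 0 < 1 - x by rewrite subr_gt0.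
exists (1 - x)^-1; first by rewrite invr_gt0.
move=> S uS; pose M := (\max_(g <- S) word_length g).+1.
pose L := [seq (n, g) | n <- iota 0 M, g <- word_products n].
pose F (u : nat * basilica) : R := expR (- (2 * u.1%:R)).
apply: (@le_trans _ _ (\sum_(u <- L) F u)).
  apply: (@ler_sum_inj _ _ (fun g => (word_length g, g)) F) => //.
  - by move=> u; apply: expR_ge0.
  - by move=> g h [].
  move=> _ /mapP[g gS ->]; apply/allpairsPdep; exists (word_length g), g.
  split=> //; last exact: mem_word_products.
  by rewrite mem_iota /= add0n ltnS; apply: leq_bigmax_seq.
rewrite big_allpairs_dep.
have E n : \sum_(g <- word_products n) F (n, g) = x ^+ n.
  rewrite /F /= big_const_seq count_predT size_word_products iter_addr_0.
  by rewrite -mulNr expRM_natr /x exprMn -[LHS]mulr_natl natrX.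
rewrite (eq_bigr _ (fun n _ => E n)).
rewrite -{1}[M]subn0 -/(index_iota 0 M) big_mkord.
by apply: sum_geometric_le; rewrite x0.
Qed.

(** By [section_inj] the sum over the elements is at most the sum over the
    pairs of sections, which is a product, times the number of pairs of
    Booleans that [top_perm] can take on the two letters. *)
Lemma split_length_exp_summable N : exp_summable N -> exp_summable (split_length N).
Proof.
move=> [A A0 NA]; exists (4 * (A * A)); first by rewrite !mulr_gt0.
move=> S uS; pose Si i := undup (map (section i) S).
pose f g := ((top_perm g false, top_perm g true), (section false g, section true g)).
pose W g := expR (- (2 * (N g)%:R)) : R.
pose F (u : (bool * bool) * (basilica * basilica)) : R := W u.2.1 * W u.2.2.
pose B := [:: (false, false); (false, true); (true, false); (true, true)].
pose L := [seq (t, uv) | t <- B, uv <- [seq (u, v) | u <- Si false, v <- Si true]].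
have W0 g : 0 <= W g by apply: expR_ge0.
apply: (@le_trans _ _ (\sum_(g <- S) F (f g))).
  by apply: ler_sum => g _; rewrite /F /W /f /= -expRD /split_length natrD mulrDr opprD.
apply: (@le_trans _ _ (\sum_(u <- L) F u)).
  apply: ler_sum_inj => //.
  - by move=> u; rewrite mulr_ge0.
  - by move=> g h [tf tt sf st]; apply: section_inj => -[].
  move=> _ /mapP[g gS ->]; rewrite /f; apply: allpairs_f.
    by case: (top_perm g false); case: (top_perm g true).
  by apply: allpairs_f; rewrite mem_undup map_f.
rewrite big_allpairs /=.
have E (t : bool * bool) : \sum_(uv <- [seq (u, v) | u <- Si false, v <- Si true]) F (t, uv) <= A * A.
  rewrite big_allpairs /F /=.
  under eq_bigr do rewrite -mulr_sumr.
  rewrite -mulr_suml ler_pM ?sumr_ge0 //; exact/NA/undup_uniq.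
apply: le_trans (ler_sum _ (fun t _ => E t)) _.
rewrite !big_cons big_nil; lra.
Qed.

Lemma level_length_exp_summable k : exp_summable (level_length k).
Proof.
elim: k => [|k]; [exact: word_length_exp_summable | exact: split_length_exp_summable].
Qed.

End Growth.

(** * The sections of the walk contract *)

Section Renormalization.
Variable R : realType.

Definition weight_a (r : R) : R := (2 + 2 * r)^-1.
Definition weight_b (r : R) : R := r / (2 + 2 * r).

Lemma weight_a_ge0 r : 0 < r -> 0 <= weight_a r.
Proof. by move=> r0; rewrite /weight_a invr_ge0; lra. Qed.

Lemma weight_b_ge0 r : 0 < r -> 0 <= weight_b r.
Proof. by move=> r0; rewrite /weight_b divr_ge0 //; lra. Qed.

Lemma weight_sum r : 0 < r -> weight_a r * 2 + weight_b r * 2 = 1.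
Proof.
move=> r0; have h : 0 < 2 + 2 * r by lra.
by rewrite /weight_a /weight_b; field; rewrite lt0r_neq0.
Qed.

Definition step_avg (r : R) := markov gen_a gen_b (weight_a r) (weight_b r).

Definition expect (r : R) (n : nat) (f : basilica -> R) : R :=
  iter n (step_avg r) f 1%g.

(** The number of moves of a first-level section of the walk per unit of
    time.  From a state in which it can move it moves with probability
    2 p + q, for p, q the weights of a and b, and two units of time pass
    on average between such occasions. *)
Definition section_rate (r : R) : R := (2 + r) / (4 * (1 + r)).

Lemma section_rate_gt0 r : 0 < r -> 0 < section_rate r.
Proof. by move=> r0; rewrite divr_gt0 //; lra. Qed.

Lemma weight_a_dual r : 0 < r -> weight_a (2 / r) = r / (2 * (2 + r)).
Proof.
move=> r0; have [h1 h2] : 0 < 2 + r /\ 0 < 2 * r + 4 by split; lra.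
by rewrite /weight_a; field; rewrite !lt0r_neq0.
Qed.

Lemma weight_b_dual r : 0 < r -> weight_b (2 / r) = (2 + r)^-1.
Proof.
move=> r0; have [h1 h2] : 0 < 2 + r /\ 0 < 2 * r + 4 by split; lra.
by rewrite /weight_b; field; rewrite !lt0r_neq0.
Qed.

(** The one-step identity behind the case of [section_walk_le] in which the
    section is active: the steps a, a^-1 move it by b, b^-1, and each of
    b, b^-1 makes it dormant; u1, ..., u4 are the values of the potential
    after a move by a, a^-1, b, b^-1. *)
Lemma section_step_balance r (u1 u2 u3 u4 u c n j K : R) : 0 < r ->
  u = weight_a (2 / r) * (u1 + u2) + weight_b (2 / r) * (u3 + u4) ->
  let v x k := x - c / section_rate r * k in
  let t0 := (1 + r) / r in
  weight_a r * ((v u3 j + c * n + K) + (v u4 j + c * n + K)) +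
  weight_b r * ((2^-1 * (v u1 j + v u (j + 1)) + c * (n - t0) + K) +
                (2^-1 * (v u (j + 1) + v u2 j) + c * (n - t0) + K)) =
  v u (j + 1) + c * (n + 1) + K.
Proof.
move=> r0 -> /=; rewrite weight_a_dual // weight_b_dual //.
have [h1 h2 h3] : [/\ 0 < 2 + r, 0 < 1 + r & 0 < 2 + 2 * r] by split; lra.
rewrite /weight_a /weight_b /section_rate; field.
by rewrite !lt0r_neq0.
Qed.

(** The one-step identity for a dormant section: a, a^-1 leave it dormant, and
    b, b^-1 wake it up with or without a move. *)
Lemma switch_step_balance r (u1 u2 c n K : R) : 0 < r ->
  let t0 := (1 + r) / r in
  weight_a r * ((2^-1 * (u1 + u2) + c * (n - t0) + K) +
                (2^-1 * (u1 + u2) + c * (n - t0) + K)) +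
  weight_b r * ((u1 + c * n + K) + (u2 + c * n + K)) =
  2^-1 * (u1 + u2) + c * (n + 1 - t0) + K.
Proof.
move=> r0 /=.
have [h1 h2] : 0 < 1 + r /\ 0 < 2 + 2 * r by split; lra.
rewrite /weight_a /weight_b; field.
by rewrite !lt0r_neq0.
Qed.

Section SectionWalk.
Variables (r : R) (N : basilica -> nat) (m : nat).
Hypotheses (r0 : 0 < r) (NL : length_like gen_a gen_b N) (m0 : (0 < m)%N).

(** Cut the moves of the section walk into blocks of m.  [U j h] is the
    expected length at the end of a block when the section is h and j moves
    are left; [B j h] subtracts what a growth at speed [c] grants to these
    moves, namely [c / section_rate r] for each.  A section at a vertex that
    the walk has carried to the letter 0 is dormant: a and a^-1 do not act on
    it, until b or b^-1 wakes it up after a mean time of [t0]. *)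
Let U j h : R := iter j (step_avg (2 / r)) (fun g => (N g)%:R) h.
Let c : R := section_rate r * (U m 1%g / m%:R).
Let B j h : R := U j h - c / section_rate r * j%:R.
Let t0 : R := (1 + r) / r.
Let K : R := m%:R + 1 + c / section_rate r * m%:R + c * t0.

Let r20 : 0 < 2 / r.
Proof. by rewrite divr_gt0. Qed.

Let c_ge0 : 0 <= c.
Proof.
apply: mulr_ge0; first exact: ltW (section_rate_gt0 r0).
apply: divr_ge0 => //; rewrite /U /step_avg.
by apply: (iter_markov_ge0 gen_a gen_b (weight_a_ge0 r20) (weight_b_ge0 r20) (weight_sum r20)).
Qed.

Let U_ge j h : (N h)%:R - j%:R <= U j h.
Proof.
elim: j h => [|j IH] h; first by rewrite subr0.
apply: (markov_ge_cst (weight_a_ge0 r20) (weight_b_ge0 r20) (weight_sum r20)).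
move=> s sS; apply: le_trans (IH _); rewrite -[j.+1]addn1 natrD.
have := length_like_stepV h NL sS; rewrite -(ler_nat R) -[(N _).+1]addn1 natrD; lra.
Qed.

Let B_ge j h : (j <= m)%N -> (N h)%:R - m%:R - c / section_rate r * m%:R <= B j h.
Proof.
move=> jm; rewrite /B; have := U_ge j h.
have jmR : j%:R <= m%:R :> R by rewrite ler_nat.
have : c / section_rate r * j%:R <= c / section_rate r * m%:R.
  by rewrite ler_wpM2l // divr_ge0 // ltW // section_rate_gt0.
lra.
Qed.

Let U_le h : U m h <= (N h)%:R + U m 1%g.
Proof.
apply: (expected_length_shift_le (weight_a_ge0 r20) (weight_b_ge0 r20)
  (weight_sum r20) NL).
Qed.

(** A finished block is charged by subadditivity; [c] is the speed at which
    this closes the induction. *)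
Let Bm_le h : B m h <= B 0 h.
Proof.
have mR0 : 0 < m%:R :> R by rewrite ltr0n.
have -> : B 0 h = (N h)%:R by rewrite /B mulr0 subr0.
have -> : B m h = U m h - U m 1%g.
  rewrite /B /c; move: (U m 1%g) (section_rate_gt0 r0) => u; set s := section_rate r => s0.
  by field; rewrite !lt0r_neq0.
rewrite lerBlDr; exact: U_le.
Qed.

(** The section is active if [top_perm g i] holds, and dormant otherwise; j
    counts the moves left in the current block.  A dormant section is
    multiplied by 1 or a^-1 on waking up, each with probability 1/2, whence
    the average of two potentials.  They need different j, since the step into
    dormancy has already contributed a or 1: the contributions a and a^-1, or
    1 and 1, make no move together, while a and 1, or 1 and a^-1, make one. *)
Lemma section_walk_le i n g :
  let e := iter n (step_avg r) (fun g => (N (section i g))%:R) g in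
  if top_perm g i then
    forall j, (j <= m)%N -> e <= B j (section i g) + c * n%:R + K
  else
    forall j1 j2, (j1 <= m)%N -> (j2 <= m)%N ->
    e <= 2^-1 * (B j1 (section i g) + B j2 (section i g * gen_a^-1)%g) +
         c * (n%:R - t0) + K.
Proof.
have rp := r0; have ct0 : 0 <= c * t0 by rewrite mulr_ge0 // divr_ge0 ?ltW //; lra.
have cm0 : 0 <= c / section_rate r * m%:R.
  by rewrite mulr_ge0 // divr_ge0 // ltW // section_rate_gt0.
have mR0 : 0 <= m%:R :> R by [].
elim: n g => [|n IH] g /=.
  case: ifP => _ => [j jm|j1 j2 jm1 jm2].
    by have := B_ge (section i g) jm; rewrite mulr0 /K; lra.
  have := B_ge (section i g) jm1; have := B_ge (section i g * gen_a^-1)%g jm2.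
  have aS : (gen_a^-1)%g \in sym_gens gen_a gen_b by rewrite !inE eqxx ?orbT.
  have := length_like_stepV (section i g) NL aS; rewrite -(ler_nat R) -[(N _).+1]addn1 natrD.
  by rewrite sub0r mulrN /K; lra.
have := IH (g * gen_a)%g; have := IH (g * gen_a^-1)%g.
have := IH (g * gen_b)%g; have := IH (g * gen_b^-1)%g.
rewrite /step_avg /markov -/(step_avg r).
rewrite !top_permM !sectionM top_perm_a top_perm_aV top_perm_b top_perm_bV.
rewrite section_a section_aV section_b section_bV.
move: (iter n _ _ _) (iter n _ _ _) (iter n _ _ _) (iter n _ _ _).
move: (section i g) => h; move=> {IH} ea eaV eb ebV.
have pa0 := weight_a_ge0 r0; have pb0 := weight_b_ge0 r0.
have W1 u v u' v' : u <= u' -> v <= v' ->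
    weight_a r * (u + v) <= weight_a r * (u' + v').
  by move=> ? ?; rewrite ler_wpM2l // lerD.
have W2 u v u' v' : u <= u' -> v <= v' ->
    weight_b r * (u + v) <= weight_b r * (u' + v').
  by move=> ? ?; rewrite ler_wpM2l // lerD.
rewrite -[n.+1]addn1 natrD; case: (top_perm g i) => /= HbV Hb HaV Ha.
  have S j : (j < m)%N -> weight_a r * (ea + eaV) + weight_b r * (eb + ebV) <=
      B j.+1 h + c * (n%:R + 1) + K.
    move=> jm.
    have := HbV j.+1 j jm (ltnW jm); rewrite mulg1 => {}HbV.
    have := Hb j j.+1 (ltnW jm) jm; rewrite mulgK => {}Hb.
    have E : U j.+1 h = weight_a (2 / r) * (U j (h * gen_a)%g + U j (h * gen_a^-1)%g) +
      weight_b (2 / r) * (U j (h * gen_b)%g + U j (h * gen_b^-1)%g) by [].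
    have BS u : B j.+1 u = U j.+1 u - c / section_rate r * (j%:R + 1).
      by rewrite /B -natr1.
    rewrite BS in Hb HbV *.
    rewrite -(section_step_balance c n%:R j%:R K r0 E).
    apply: lerD; [apply: W1|apply: W2] => //.
    - exact: Ha (ltnW jm).
    - exact: HaV (ltnW jm).
  (* An exhausted block is replaced by a fresh one of m moves. *)
  case=> [|j] jm; last exact: S.
  have := S m.-1; rewrite prednK // => /(_ (leqnn _)) /le_trans; apply.
  by rewrite !lerD2r Bm_le.
move=> j1 j2 jm1 jm2; rewrite -(switch_step_balance _ _ c n%:R K r0).
apply: lerD; [apply: W1|apply: W2].
- by have := Ha j1 j2 jm1 jm2; rewrite mulg1.
- by have := HaV j1 j2 jm1 jm2; rewrite mulg1.
- by have := Hb j1 jm1; rewrite mulg1.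
- exact: HbV.
Qed.

Lemma section_walk_drift : exists K' : R, forall i n,
  expect r n (fun g => (N (section i g))%:R) <=
  section_rate r * (expect (2 / r) m (fun g => (N g)%:R) / m%:R) * n%:R + K'.
Proof.
exists (K + 1) => i n; rewrite /expect -/(U m 1%g) -/c.
have ct0 : 0 <= c * t0.
  by rewrite mulr_ge0 // divr_ge0 // ltW //; apply: addr_gt0.
have := section_walk_le i n 1%g; rewrite top_perm1 section1 mul1g /=.
have B0 h : B 0 h = (N h)%:R by rewrite /B mulr0 subr0.
case: i => [/(_ 0%N isT)|/(_ 0%N 0%N isT isT)]; rewrite !B0 (length_like1 NL); first by lra.
have : (N (gen_a^-1)%g)%:R <= 1 :> R.
  by rewrite (ler_nat R _ 1) (length_like_gen NL) // !inE eqxx orbT.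
rewrite mulrBr; lra.
Qed.

End SectionWalk.

(** The upper limit of E N(Z_n) / n is at most d, for the walk of ratio r. *)
Definition drift_le (r : R) (N : basilica -> nat) (d : R) :=
  forall e : R, 0 < e -> exists K : R, forall n,
    expect r n (fun g => (N g)%:R) <= (d + e) * n%:R + K.

Lemma length_like_drift_le1 r N : 0 < r -> length_like gen_a gen_b N -> drift_le r N 1.
Proof.
move=> r0 NL e e0; exists 0 => n; rewrite addr0.
apply: le_trans (expected_length_le_time (weight_a_ge0 r0) (weight_b_ge0 r0) (weight_sum r0) NL n) _.
by rewrite mulrDl mul1r lerDl mulr_ge0 // ltW.
Qed.

(** [section_walk_drift] for the two sections, with m so large that the
    average length over a block of m moves is close to d. *)
Lemma drift_le_split r N d : 0 < r -> length_like gen_a gen_b N -> drift_le (2 / r) N d ->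
  drift_le r (split_length N) (2 * section_rate r * d).
Proof.
move=> r0 NL Nd e e0.
have s0 := section_rate_gt0 r0.
have s1 : 2 * section_rate r <= 1.
  rewrite /section_rate mulrA ler_pdivrMr; lra.
have [K0 HK] := Nd (e / 2) (divr_gt0 e0 (ltr0n _ 2)).
have [m m0 Em] : exists2 m, (0 < m)%N &
    expect (2 / r) m (fun g => (N g)%:R) / m%:R <= d + e.
  pose M := Num.truncn (K0 / (e / 2)).
  have HM : K0 < M.+1%:R * (e / 2).
    by rewrite -ltr_pdivrMr ?divr_gt0 // Num.Theory.truncnS_gt.
  exists M.+1 => //; rewrite ler_pdivrMr ?ltr0n //; apply: le_trans (HK _) _.
  by move: HM; rewrite mulrDl; lra.
have [K W] := section_walk_drift r0 NL m0.
move: Em W; set X := _ / m%:R => Em W.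
exists (K + K) => n; rewrite /expect /split_length.
have -> : iter n (step_avg r)
      (fun g => (N (section false g) + N (section true g))%:R) 1%g =
    1 * expect r n (fun g => (N (section false g))%:R) +
    1 * expect r n (fun g => (N (section true g))%:R).
  rewrite -iter_markov_lin; apply: eq_iter_markov => g.
  by rewrite natrD !mul1r.
have XR : section_rate r * X * n%:R * 2 <= (2 * section_rate r * d + e) * n%:R.
  rewrite mulrAC ler_wpM2r //.
  have : section_rate r * X <= section_rate r * (d + e) by rewrite ler_wpM2l // ltW.
  have : 2 * section_rate r * e <= 1 * e by rewrite ler_wpM2r // ltW.
  rewrite mulrDr; lra.
rewrite !mul1r; have := W false n; have := W true n; lra.
Qed.

(** Two levels at a time, since r becomes 2 / r and then r again. *)
Lemma drift_le_level r k : 0 < r -> drift_le r (level_length (k + k)) (2^-1 ^+ k).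
Proof.
move=> r0; elim: k => [|k IH].
  by rewrite expr0; apply: length_like_drift_le1 => //; apply: word_length_like.
have r20 : 0 < 2 / r by rewrite divr_gt0.
have rr : 2 / (2 / r) = r by field; rewrite lt0r_neq0.
have -> : 2^-1 ^+ k.+1 = 2 * section_rate r * (2 * section_rate (2 / r) * 2^-1 ^+ k).
  have [h1 h2] : 0 < 1 + r /\ 0 < 2 + r by split; lra.
  rewrite exprS /section_rate; field.
  rewrite !lt0r_neq0 //=; lra.
rewrite addSn addnS /level_length !iterS -/(level_length (k + k)).
have L := level_length_like (k + k).
apply: drift_le_split => //; first exact: split_length_like.
by apply: drift_le_split => //; rewrite rr.
Qed.

(** In [expected_length_le] divided by e, the entropy term is made at most e n
    by the choice of the level k, and the other term is e n. *)
Lemma expected_word_length_sublinear r : 0 < r -> forall d : R, 0 < d ->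
  exists K : R, forall n, expect r n (fun g => (word_length g)%:R) <= d * n%:R + K.
Proof.
move=> r0 d d0; pose e := Num.min 2^-1 (d / 2).
have e0 : 0 < e by rewrite /e lt_min invr_gt0 ltr0n divr_gt0.
have [e1 e2] : e <= 2^-1 /\ e <= d / 2.
  by rewrite /e !ge_min !lexx; split=> //; rewrite orbT.
have [k Hk] : exists k, 2^-1 ^+ k <= e ^+ 2 / 4.
  exists (Num.bound ((e ^+ 2 / 4)^-1)); rewrite exprVn.
  rewrite -[leRHS]invrK lef_pV2 ?posrE ?invr_gt0 ?divr_gt0 ?exprn_gt0 //.
  by apply/ltW/Num.Theory.upper_nthrootP.
have [K HK] := drift_le_level k r0 (divr_gt0 (exprn_gt0 2 e0) (ltr0n R 4)).
have [A A0 HA] := level_length_exp_summable R (k + k).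
exists ((2 * K + ln (2 * A)) / e) => n.
have e01 : 0 <= e <= 2^-1 by rewrite (ltW e0).
have := expected_length_le (weight_a_ge0 r0) (weight_b_ge0 r0) (weight_sum r0)
  word_length_like n e01 A0 HA.
have -> : iter n (markov gen_a gen_b (weight_a r) (weight_b r))
    (fun g => 2 * (level_length (k + k) g)%:R) 1%g =
    2 * expect r n (fun g => (level_length (k + k) g)%:R).
  rewrite -[RHS]addr0 -[X in _ + X](mul0r (expect r n (fun _ => 0))).
  by rewrite -iter_markov_lin; apply: eq_iter_markov => g; rewrite mul0r addr0.
rewrite -/(step_avg r) -/(expect r n _) => H.
rewrite -(ler_pM2l e0); apply: le_trans H _.
rewrite mulrDr [e * (_ / e)]mulrC divfK ?lt0r_neq0 //.
have h1 : (2^-1 ^+ k + e ^+ 2 / 4) * n%:R <= e ^+ 2 / 2 * n%:R.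
  by rewrite ler_wpM2r //; lra.
have h2 : 2 * e ^+ 2 * n%:R <= e * (d * n%:R).
  rewrite [leRHS]mulrA ler_wpM2r // expr2 mulrCA ler_wpM2l ?(ltW e0) //.
  lra.
have := HK n; lra.
Qed.

Lemma word_length_tail r (e : R) : 0 < r -> 0 < e ->
  exists C k : R, 0 < k /\ forall n,
    expect r n (fun g => (e * n%:R <= (word_length g)%:R)%R%:R) <= C * expR (- (k * n%:R)).
Proof.
move=> r0 e0; apply: (tail_of_sublinear (weight_a_ge0 r0) (weight_b_ge0 r0)
  (weight_sum r0) word_length_like e0).
exact: expected_word_length_sublinear r0.
Qed.

End Renormalization.

(** * From the averaging operator to the probability space *)

(** The weights of [step_law] add up on coinciding generators, so the
    generators have to be told apart. *)
Lemma basilica_gens_neq :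
  [/\ gen_a != (gen_a^-1)%g, gen_b != (gen_b^-1)%g &
   [/\ gen_a != gen_b, gen_a != (gen_b^-1)%g,
       (gen_a^-1)%g != gen_b & (gen_a^-1)%g != (gen_b^-1)%g]].
Proof.
have topN g h i : top_perm g i != top_perm h i -> g != h.
  by apply: contra_neq => ->.
have secN g h i : section i g != section i h -> g != h.
  by apply: contra_neq => ->.
have ab : gen_a != gen_b by apply: (@topN _ _ true); rewrite top_perm_a top_perm_b.
have b1 : gen_b != 1%g by apply: (@topN _ _ true); rewrite top_perm_b top_perm1.
have a1 : gen_a != 1%g by apply: (@secN _ _ true); rewrite section_a section1.
have bB : gen_b != (gen_b^-1)%g.
  by apply: (@secN _ _ true); rewrite section_b section_bV.
have aA : gen_a != (gen_a^-1)%g.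
  by apply: (@secN _ _ true); rewrite section_a section_aV.
have aB : gen_a != (gen_b^-1)%g.
  by apply: (@topN _ _ true); rewrite top_perm_a top_perm_bV.
have Ab : (gen_a^-1)%g != gen_b.
  by apply: (@topN _ _ true); rewrite top_perm_aV top_perm_b.
have AB : (gen_a^-1)%g != (gen_b^-1)%g.
  by apply: (@topN _ _ true); rewrite top_perm_aV top_perm_bV.
by [].
Qed.

Section AlmostSure.
Local Open Scope ereal_scope.
Variables (d : measure_display) (Omega : measurableType d) (R : realType).
Variables (P : probability Omega R) (r : R) (s : nat -> {RV P >-> basilica}).
Hypotheses (r0 : (0 < r)%R) (indep : mutually_independent s).
Hypothesis law : forall (i : nat) (A : set basilica),
  distribution P (s i) A = step_law r A.

Lemma step_probE i (A : set basilica) : P (s i @^-1` A) = step_law r A.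
Proof. exact: law. Qed.

Lemma step_prob_gen i :
  [/\ P (s i @^-1` [set gen_a]) = (weight_a r)%:E,
      P (s i @^-1` [set gen_a^-1%g]) = (weight_a r)%:E,
      P (s i @^-1` [set gen_b]) = (weight_b r)%:E &
      P (s i @^-1` [set gen_b^-1%g]) = (weight_b r)%:E].
Proof.
have [n1 n2 [n3 n4 n5 n6]] := basilica_gens_neq.
have D (x y : basilica) : \d_x [set y] = (x == y)%:R%:E :> \bar R.
  have xyE : (x \in [set y]) = (x == y) by apply/idP/eqP; rewrite in_setE.
  by rewrite diracE xyE.
have E (x y : basilica) : x != y -> ((x == y) = false) * ((y == x) = false).
  by move=> xy; split; [|rewrite eq_sym]; apply/negbTE.
rewrite !step_probE /step_law !D !eqxx.
rewrite !(E _ _ n1) !(E _ _ n2) !(E _ _ n3) !(E _ _ n4) !(E _ _ n5) !(E _ _ n6).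
rewrite -!EFinD /weight_a /weight_b mulr1n mulr0n !addr0 !add0r !mulr0 !mulr1.
by rewrite addr0 add0r.
Qed.

Lemma step_prob_other i : P (s i @^-1` [set g | g \notin basilica_gens]) = 0.
Proof.
rewrite step_probE /step_law.
have D g : g \in basilica_gens -> \d_g [set g | g \notin basilica_gens] = 0 :> \bar R.
  move=> gS; rewrite diracE memNset //= => /negP; exact.
have [ha hA hb hB] := sym_gensP D.
by rewrite ha hA hb hB !adde0 !mule0 adde0.
Qed.

Definition cylinder (k : nat) (w : nat -> basilica) : set Omega :=
  [set om | forall j, (j < k)%N -> s j om = w j].

Let step_measurable i (A : set basilica) : measurable (s i @^-1` A).
Proof. exact: measurable_funPTI. Qed.

(** The index sets of the cylinders, built so that a new step is added by
    [big_fsetU1]. *)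
Fixpoint fset_below (k : nat) : {fset nat} :=
  (if k is k'.+1 then k' |` fset_below k' else fset0)%fset.

Lemma in_fset_below k j : (j \in fset_below k) = (j < k)%N.
Proof.
elim: k => [|k IH] /=; first by rewrite in_fset0.
by rewrite in_fset1U IH ltnS [RHS]leq_eqVlt.
Qed.

Lemma cylinderE k w :
  cylinder k w = \bigcap_(j in [set` fset_below k]) (s j @^-1` [set w j]).
Proof.
apply/seteqP; split=> om /= h j; first by rewrite /= in_fset_below; apply: h.
by move=> jk; apply: h; rewrite /= in_fset_below.
Qed.

Lemma measurable_cylinder k w : measurable (cylinder k w).
Proof.
by rewrite cylinderE; apply: bigcap_measurableType => // j _; apply: step_measurable.
Qed.

Lemma cylinderS k w t (w' := fun j => if (j < k)%N then w j else t) :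
  cylinder k w `&` s k @^-1` [set t] = cylinder k.+1 w'.
Proof.
apply/seteqP; split=> om; rewrite /cylinder /w' /=.
  move=> [h <-] j; rewrite ltnS leq_eqVlt => /orP[/eqP->|jk].
    by rewrite ltnn.
  by rewrite jk h.
move=> h; split; last by rewrite h // ltnn.
by move=> j jk; rewrite h ?jk // ltnS ltnW.
Qed.

Lemma cylinder_prob k w :
  P (cylinder k w) = \prod_(j <- fset_below k) P (s j @^-1` [set w j]).
Proof. by rewrite cylinderE indep. Qed.

Lemma cylinder_step_prob k w t :
  P (cylinder k w `&` s k @^-1` [set t]) = P (s k @^-1` [set t]) * P (cylinder k w).
Proof.
rewrite cylinderS !cylinder_prob /= big_fsetU1 /=; last first.
  by rewrite in_fset_below ltnn.
rewrite ltnn; congr (_ * _); apply: eq_big_seq => j.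
by rewrite in_fset_below => ->.
Qed.

(** The law of the walk is bounded by induction on the number of steps to come,
    conditioning on the past through cylinders.  Measurable covers take the
    place of the events themselves, as a step may leave the generators on a
    null set. *)
Lemma walk_cover (A : pred basilica) n k w (c : R) : P (cylinder k w) = c%:E ->
  exists M : set Omega,
    [/\ measurable M, cylinder k w `&` [set om | A (walk s (k + n) om)] `<=` M &
    P M <= (c * iter n (step_avg r) (fun g => (A g)%:R) (\prod_(0 <= j < k) w j)%g)%:E].
Proof.
elim: n k w c => [|n IH] k w c Pc.
  have walkE om : cylinder k w om -> walk s (k + 0) om = (\prod_(0 <= j < k) w j)%g.
    by move=> h; rewrite addn0; apply: eq_big_nat => j /andP[_]; apply: h.
  have [Aw|Aw] := boolP (A (\prod_(0 <= j < k) w j)%g).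
    exists (cylinder k w); split=> [|om []//|]; first exact: measurable_cylinder.
    by rewrite Pc /= Aw mulr1.
  exists set0; split=> //= [om [/walkE /= ->]|]; first by rewrite (negbTE Aw).
  by rewrite measure0 (negbTE Aw) mulr0.
have H t v : P (s k @^-1` [set t]) = v%:E -> exists M : set Omega, [/\ measurable M,
    cylinder k w `&` s k @^-1` [set t] `&` [set om | A (walk s (k + n.+1) om)] `<=` M &
    P M <= (v * c * iter n (step_avg r) (fun g => (A g)%:R)
      (\prod_(0 <= j < k) w j * t)%g)%:E].
  move=> Pv; have := cylinder_step_prob k w t; rewrite cylinderS Pv Pc -EFinM => Pvc.
  have [M [mM AM PM]] := IH _ _ _ Pvc; exists M; split=> //.
    by rewrite addnS -addSn.
  move: PM; rewrite big_nat_recr //= ltnn.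
  suff -> : (\prod_(0 <= j < k) (if (j < k)%N then w j else t) =
             \prod_(0 <= j < k) w j)%g by [].
  by apply: eq_big_nat => j /andP[_ ->].
have [Pa PA Pb PB] := step_prob_gen k.
have [Ma [mMa aMa PMa]] := H _ _ Pa; have [MA [mMA aMA PMA]] := H _ _ PA.
have [Mb [mMb aMb PMb]] := H _ _ Pb; have [MB [mMB aMB PMB]] := H _ _ PB.
have N0 := step_prob_other k; pose N := s k @^-1` [set g | g \notin basilica_gens].
have mN : measurable N by apply: step_measurable.
exists ((Ma `|` MA) `|` (Mb `|` MB) `|` N); split.
- by repeat apply: measurableU.
- move=> om [Cw Aw]; have [|sk] := boolP (s k om \in basilica_gens); last by right.
  rewrite !inE => /or4P[] /eqP sk; left; [left; left|left; right|right; left|right; right].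
  + by apply: aMa.
  + by apply: aMA.
  + by apply: aMb.
  + by apply: aMB.
rewrite -[leRHS]adde0 -[in leRHS]N0.
apply: le_trans (measureU2 _ _ mN) _; first by repeat apply: measurableU.
rewrite leeD2r //.
apply: le_trans (measureU2 _ (measurableU _ _ mMa mMA) (measurableU _ _ mMb mMB)) _.
apply: le_trans (leeD (measureU2 _ mMa mMA) (measureU2 _ mMb mMB)) _.
apply: le_trans (leeD (leeD PMa PMA) (leeD PMb PMB)) _.
rewrite -!EFinD lee_fin /= /step_avg /markov le_eqVlt; apply/orP; left; apply/eqP.
ring.
Qed.

Lemma walk_prob_cover (A : pred basilica) n : exists M : set Omega,
  [/\ measurable M, [set om | A (walk s n om)] `<=` M &
  P M <= (expect r n (fun g => (A g)%:R))%:E].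
Proof.
have C1 : P (cylinder 0 (fun _ => 1%g)) = 1%:E.
  by rewrite cylinderE [fset_below 0]/= set_fset0 bigcap_set0 probability_setT.
have [M [mM AM PM]] := walk_cover A n C1.
by exists M; split=> // [om Aom|]; [apply: AM | move: PM; rewrite mul1r big_nil].
Qed.

(** Borel-Cantelli, with the exponential tail of [word_length_tail]. *)
Lemma ae_eventually_short (e : R) : (0 < e)%R ->
  {ae P, forall om, exists n0, forall n, (n0 <= n)%N ->
     ((word_length (walk s n om))%:R < e * n%:R)%R}.
Proof.
move=> e0; have [C [k [k0 tail]]] := word_length_tail r0 e0.
pose A n := [pred g | (e * n%:R <= (word_length g)%:R)%R].
have /choice[M HM] := fun n => walk_prob_cover (A n) n.
have mM n : measurable (M n) by have [] := HM n.
pose x := expR (- k); have x0 : (0 < x)%R by apply: expR_gt0.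
have x1 : (x < 1)%R by rewrite /x expR_lt1 oppr_lt0.
have C0 : (0 <= C)%R.
  have := tail 0%N; rewrite !mulr0 oppr0 expR0 mulr1; apply: le_trans.
  exact: ler0n.
have PM n : P (M n) <= (C * x ^+ n)%:E.
  have [_ _ /le_trans] := HM n; apply; rewrite lee_fin; apply: le_trans (tail n) _.
  by rewrite -mulNr expRM_natr.
have sumM : \sum_(n <oo) P (M n) < +oo.
  apply: (@le_lt_trans _ _ (C / (1 - x))%:E); last exact: ltry.
  apply: lime_le; first by apply: is_cvg_nneseries.
  apply: nearW => n.
  apply: (@le_trans _ _ (\sum_(0 <= i < n) (C * x ^+ i)%:E)).
    by apply: lee_sum => i _; apply: PM.
  rewrite sumEFin lee_fin -mulr_sumr ler_wpM2l // big_mkord.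
  by apply: sum_geometric_le; rewrite (ltW x0).
exists (lim_sup_set M); split.
- by apply: bigcap_measurableType => j _; apply: bigcup_measurable.
- exact: lim_sup_set_cvg0.
move=> om /= nA j _; apply: contrapT => Mj; apply: nA; exists j => n jn.
rewrite ltNge; apply/negP => en; apply: Mj; exists n => //.
by have [_ AM _] := HM n; apply: AM.
Qed.

Lemma walk_sublinear :
  {ae P, forall om,
    ((word_length (walk s n om))%:R / n%:R : R)%R @[n --> \oo] --> (0 : R)%R}.
Proof.
have : \forall om \ae P, forall q : nat, exists n0, forall n, (n0 <= n)%N ->
     ((word_length (walk s n om))%:R < q.+1%:R^-1 * n%:R :> R)%R.
  by apply/ae_foralln => q; apply: ae_eventually_short; rewrite invr_gt0.
apply: filterS => om h; apply/cvgrPdist_lt => e e0.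
have [n0 Hn] := h (Num.truncn e^-1).
exists n0.+1 => // n /= nn0; rewrite sub0r normrN ger0_norm ?divr_ge0 //.
have n_gt0 : (0 < n%:R :> R)%R by rewrite ltr0n (leq_trans _ nn0).
rewrite ltr_pdivrMr //; apply: lt_le_trans (Hn n (ltnW nn0)) _.
rewrite ler_wpM2r // -[leRHS]invrK lef_pV2 ?posrE ?invr_gt0 //.
exact/ltW/Num.Theory.truncnS_gt.
Qed.

End AlmostSure.

Theorem theorem1 (d : measure_display) (Omega : measurableType d) (R : realType)
    (P : probability Omega R) (r : R) (s : nat -> {RV P >-> basilica}) :
  0 < r ->
  mutually_independent s ->
  (forall (i : nat) (A : set basilica), distribution P (s i) A = step_law r A) ->
  {ae P, forall omega,
    ((word_length (walk s n omega))%:R / n%:R : R) @[n --> \oo] --> (0 : R)}.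
Proof. exact: walk_sublinear. Qed.
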